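(* Let $\gamma:\mathbb{R}^2\to\mathbb{R}^3\simeq su(2)$ be a smooth solution of the VFE $\gamma_t=\frac12\gamma_x\times\gamma_{xx}$ parametrized by arc-length, $g=(e_0,e_1,e_2)$ an adapted p-frame along $\gamma$ with principal curvatures $k_1,k_2$, and $q=\frac12(k_1+ik_2)$. Let $\alpha_1,\alpha_2\in\mathbb{C}\setminus\mathbb{R}$ with $\alpha_1\neq\alpha_2,\bar\alpha_2$. For $i=1,2$ let $p_i:\mathbb{R}^2\to\mathbb{C}$ be a solution of $(\mathrm{BT})_{q,\alpha_i}$ and let $\tilde\pi_i$ be the Hermitian projection of $\mathbb{C}^2$ onto $\mathbb{C}(p_i,1)^t$. Let $\phi:\mathbb{R}^2\to SU(2)$ be smooth with $g=\mathrm{Ad}(\phi)[\delta]$, and put $\phi_i=\phi\left(\tilde\pi_i+\frac{\alpha_i}{\bar\alpha_i}\tilde\pi_i^\perp\right)$, $g_i=(e_0^i,e_1^i,e_2^i)=\mathrm{Ad}(\phi_i)[\delta]$ and $$\gamma_i=\gamma+\frac{\mathrm{Im}(\alpha_i)}{|\alpha_i|^2(1+|p_i|^2)}\left((1-|p_i|^2)e_0+2\mathrm{Re}(p_i)e_1+2\mathrm{Im}(p_i)e_2\right),\quad i=1,2.$$ Define $\xi=(\xi_1,\xi_2)^t=f_{\alpha_2,\tilde\pi_2}(\alpha_1)(p_1,1)^t$, $\eta=(\eta_1,\eta_2)^t=f_{\alpha_1,\tilde\pi_1}(\alpha_2)(p_2,1)^t$, assume $\xi_2,\eta_2$ are nowhere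 zero, and set $\tilde p_1=\xi_1/\xi_2$, $\tilde p_2=\eta_1/\eta_2$. Then $$\gamma_{12}=\gamma_1+\frac{\mathrm{Im}(\alpha_2)}{|\alpha_2|^2(1+|\tilde p_2|^2)}\left((1-|\tilde p_2|^2)e_0^1+2\mathrm{Re}(\tilde p_2)e_1^1+2\mathrm{Im}(\tilde p_2)e_2^1\right)$$ $$=\gamma_2+\frac{\mathrm{Im}(\alpha_1)}{|\alpha_1|^2(1+|\tilde p_1|^2)}\left((1-|\tilde p_1|^2)e_0^2+2\mathrm{Re}(\tilde p_1)e_1^2+2\mathrm{Im}(\tilde p_1)e_2^2\right)$$ (the two expressions are equal), and $\gamma_{12}$ is a solution of the VFE.
   Context: Let $a=\mathrm{diag}(i,-i)$, $b=\begin{pmatrix}0&1\\-1&0\end{pmatrix}$, $c=\begin{pmatrix}0&i\\i&0\end{pmatrix}$. Identify $su(2)$ with Euclidean $\mathbb{R}^3$ by $xa+yb+zc\mapsto(x,y,z)^t$; then the inner product is $-\frac12\mathrm{tr}(XY)$ and $X\times Y=\frac12[X,Y]$. Set $\delta=(a,-c,b)$, and for $\phi\in U(2)$ let $\mathrm{Ad}(\phi)[\delta]=(\phi a\phi^{-1},-\phi c\phi^{-1},\phi b\phi^{-1})\in SO(3)$. An adapted p-frame along $\gamma$ is a smooth $g=(e_0,e_1,e_2):\mathbb{R}^2\to SO(3)$ with $e_0=\gamma_x$ and $$g^{-1}g_x=\begin{pmatrix}0&-k_1&-k_2\\k_1&0&0\\k_2&0&0\end{pmatrix},\quad g^{-1}g_t=\begin{pmatrix}0&\frac{(k_2)_x}{2}&-\frac{(k_1)_x}{2}\\-\frac{(k_2)_x}{2}&0&\frac{k_1^2+k_2^2}{4}\\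 \frac{(k_1)_x}{2}&-\frac{k_1^2+k_2^2}{4}&0\end{pmatrix};$$ then $q=\frac12(k_1+ik_2)$ solves $q_t=\frac i2(q_{xx}+2|q|^2q)$. $(\mathrm{BT})_{q,\alpha}$ is the system for $p$: $$p_x=-\bar qp^2-2i\alpha p-q,\qquad p_t=\left(\tfrac i2\bar q_x-\alpha\bar q\right)p^2+i(|q|^2-2\alpha^2)p-\left(\alpha q+\tfrac i2q_x\right).$$ For a Hermitian projection $\pi$ ($\pi^*=\pi=\pi^2$), $\pi^\perp=I_2-\pi$ and $f_{\alpha,\pi}(\lambda)=I_2+\frac{\alpha-\bar\alpha}{\lambda-\alpha}\pi^\perp$. *)

(* Defs.v *)
From HB Require Import structures.
From mathcomp Require Import all_boot all_order all_algebra.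
From mathcomp Require Import complex.
From mathcomp Require Import all_classical all_reals all_analysis.
From mathcomp Require Import ring.

Set Implicit Arguments.
Unset Strict Implicit.
Unset Printing Implicit Defensive.

Import Order.TTheory GRing.Theory Num.Theory numFieldNormedType.Exports.

Local Open Scope ring_scope.
Local Open Scope sesquilinear_scope.

(* [z^*] is always the conjugation of ring_scope; on [R[i]] it is convertible
   to [conjc]. [complex.Re], [complex.Im] and [normc] take values in [R]. *)
Local Notation Re := complex.Re.
Local Notation Im := complex.Im.
Local Notation normc := ComplexField.Normc.normc.

Definition mx_rows (T : nmodType) (m n : nat) (s : seq (seq T)) :
  'M[T]_(m, n) := \matrix_(i, j) nth 0 (nth [::] s i) j.

(* A point of R^2 is z = (x, t). *)
Section PlaneCalculus.
Variable R : realType.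

Definition d_x (V : normedModType R) (f : R * R -> V) : R * R -> V :=
  fun z => 'D_((1, 0) : R * R) f z.

Definition d_t (V : normedModType R) (f : R * R -> V) : R * R -> V :=
  fun z => 'D_((0, 1) : R * R) f z.

Fixpoint Ck (V : normedModType R) (n : nat) (f : R * R -> V) : Prop :=
  if n is n'.+1 then
    [/\ forall z, differentiable f z, Ck n' (d_x f) & Ck n' (d_t f)]
  else continuous f.

Definition smooth (V : normedModType R) (f : R * R -> V) : Prop :=
  forall n, Ck n f.

(* [R[i]] carries no topology over [R] in the library, hence maps with complex
   values or entries are differentiated through their real and imaginary
   parts. *)
Definition differentiableC (f : R * R -> R[i]) (z : R * R) : Prop :=
  differentiable (fun w => Re (f w)) z /\ differentiable (fun w => Im (f w)) z.

Definition dC_x (f : R * R -> R[i]) : R * R -> R[i] := fun z =>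
  (d_x (fun w => Re (f w)) z +i* d_x (fun w => Im (f w)) z)%C.

Definition dC_t (f : R * R -> R[i]) : R * R -> R[i] := fun z =>
  (d_t (fun w => Re (f w)) z +i* d_t (fun w => Im (f w)) z)%C.

Definition smoothCmx (m n : nat) (f : R * R -> 'M[R[i]]_(m, n)) : Prop :=
  smooth (fun z => map_mx (@Re R) (f z)) /\
  smooth (fun z => map_mx (@Im R) (f z)).

End PlaneCalculus.

Section Euclidean3.
Variable R : realType.

(* The library norm on ['cV[R]_3] is the sup norm. *)
Definition enorm (u : 'cV[R]_3) : R := Num.sqrt (\sum_i u i 0 ^+ 2).

Definition cross (u v : 'cV[R]_3) : 'cV[R]_3 :=
  let: i0 := 0 : 'I_3 in let: i1 := 1 : 'I_3 in let: i2 := 2%:R : 'I_3 in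
  mx_rows 3 1 [:: [:: u i1 0 * v i2 0 - u i2 0 * v i1 0];
                  [:: u i2 0 * v i0 0 - u i0 0 * v i2 0];
                  [:: u i0 0 * v i1 0 - u i1 0 * v i0 0]].

Definition SO3 (g : 'M[R]_3) : Prop := g^T *m g = 1%:M /\ \det g = 1.

Definition VFE_solution (gamma : R * R -> 'cV[R]_3) : Prop :=
  smooth gamma /\
  forall z, d_t gamma z = 2^-1 *: cross (d_x gamma z) (d_x (d_x gamma) z).

Definition arclength (gamma : R * R -> 'cV[R]_3) : Prop :=
  forall z, enorm (d_x gamma z) = 1.

Definition adapted_pframe (gamma : R * R -> 'cV[R]_3) (g : R * R -> 'M[R]_3)
    (k1 k2 : R * R -> R) : Prop :=
  [/\ smooth g,
      forall z, SO3 (g z),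
      forall z, col 0 (g z) = d_x gamma z,
      forall z, invmx (g z) *m d_x g z =
        mx_rows 3 3 [:: [:: 0; - k1 z; - k2 z];
                        [:: k1 z; 0; 0];
                        [:: k2 z; 0; 0]]
    & forall z, invmx (g z) *m d_t g z =
        let: k := (k1 z ^+ 2 + k2 z ^+ 2) / 4 in
        mx_rows 3 3 [:: [:: 0; d_x k2 z / 2; - (d_x k1 z / 2)];
                        [:: - (d_x k2 z / 2); 0; k];
                        [:: d_x k1 z / 2; - k; 0]]].

End Euclidean3.

Section Su2.
Variable R : realType.
Notation C := R[i].

Definition mxa : 'M[C]_2 := mx_rows 2 2 [:: [:: 'i%C; 0]; [:: 0; - 'i%C]].
Definition mxb : 'M[C]_2 := mx_rows 2 2 [:: [:: 0; 1]; [:: - 1; 0]].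
Definition mxc : 'M[C]_2 := mx_rows 2 2 [:: [:: 0; 'i%C]; [:: 'i%C; 0]].

Definition su2_mx (v : 'cV[R]_3) : 'M[C]_2 :=
  (v 0 0)%:C%C *: mxa + (v 1 0)%:C%C *: mxb + (v 2%:R 0)%:C%C *: mxc.

(* Inverse of [su2_mx] on su(2); only meaningful there. *)
Definition su2_vec (X : 'M[C]_2) : 'cV[R]_3 :=
  mx_rows 3 1 [:: [:: Im (X 0 0)]; [:: Re (X 0 1)]; [:: Im (X 0 1)]].

Definition SU2 (phi : 'M[C]_2) : Prop := phi \is unitarymx /\ \det phi = 1.

(* The columns are the elements of Ad(phi)[delta], seen in R^3. *)
Definition Ad_delta (phi : 'M[C]_2) : 'M[R]_3 :=
  let: e := [:: phi *m mxa *m invmx phi;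
                - (phi *m mxc *m invmx phi);
                phi *m mxb *m invmx phi] in
  \matrix_(i, j) su2_vec (nth 0 e j) i 0.

Lemma mx2P (X Y : 'M[C]_2) : X 0 0 = Y 0 0 -> X 0 1 = Y 0 1 ->
  X 1 0 = Y 1 0 -> X 1 1 = Y 1 1 -> X = Y.
Proof.
move=> h00 h01 h10 h11; apply/matrixP => i j.
by case: i => -[|[|//]] hi; case: j => -[|[|//]] hj;
  [move: h00 | move: h01 | move: h10 | move: h11];
  congr (X _ _ = Y _ _); apply/val_inj.
Qed.

Lemma su2_mxE (v : 'cV[R]_3) : su2_mx v = mx_rows 2 2
  [:: [:: Complex 0 (v 0 0); Complex (v 1 0) (v 2%:R 0)];
      [:: Complex (- v 1 0) (v 2%:R 0); Complex 0 (- v 0 0)]].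
Proof.
apply: mx2P; rewrite !mxE /=; apply/eqP; rewrite eq_complex /=;
  apply/andP; split; apply/eqP; ring.
Qed.

Lemma su2_mxK : cancel su2_mx su2_vec.
Proof.
move=> v; apply/matrixP => i j; rewrite (ord1 j) su2_mxE !mxE.
by case: i => -[|[|[|//]]] hi /=; rewrite ?mxE /=; congr (v _ _);
  apply/val_inj.
Qed.

Lemma su2_vecK (X : 'M[C]_2) :
  X ^t* = - X -> \tr X = 0 -> su2_mx (su2_vec X) = X.
Proof.
rewrite /mxtrace big_ord_recl big_ord1 (_ : lift _ _ = 1); last exact/val_inj.
move=> /matrixP hX /eqP; rewrite addrC addr_eq0 => /eqP tX.
move: (hX 0 0) (hX 0 1); rewrite !mxE.
rewrite su2_mxE => h0 h1; apply: mx2P; rewrite !mxE /= ?mxE /= ?tX.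
- move: h0; case: (X 0 0) => a b [] /eqP; rewrite -addr_eq0 -mulr2n.
  by rewrite mulrn_eq0 /= => /eqP ->.
- by case: (X 0 1).
- move: h1; case: (X 0 1) => a b; case: (X 1 0) => c d [] -> /=.
  by move=> /oppr_inj ->.
- move: h0; case: (X 0 0) => a b [] /eqP; rewrite -addr_eq0 -mulr2n.
  by rewrite mulrn_eq0 /= => /eqP ->; apply/eqP; rewrite eq_complex /= oppr0 !eqxx.
Qed.

Lemma su2_mx_cross (u v : 'cV[R]_3) :
  su2_mx (cross u v) =
  2^-1 *: (su2_mx u *m su2_mx v - su2_mx v *m su2_mx u).
Proof.
apply: (scalerI (a := 2)); first by rewrite pnatr_eq0.
rewrite scalerA divff ?pnatr_eq0 // scale1r !su2_mxE.
apply: mx2P; rewrite !mxE !big_ord_recl !big_ord0 !mxE /= ;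
 apply/eqP; rewrite eq_complex /=; apply/andP; split; apply/eqP; ring.
Qed.

End Su2.

Section BacklundTransformation.
Variable R : realType.
Notation C := R[i].

Definition BT_solution (q : R * R -> C) (alpha : C) (p : R * R -> C) : Prop :=
  [/\ forall z, differentiableC p z,
      forall z, dC_x p z =
        - (q z)^* * p z ^+ 2 - 2 * 'i%C * alpha * p z - q z
    & forall z, dC_t p z =
        ('i%C / 2 * (dC_x q z)^* - alpha * (q z)^*) * p z ^+ 2
        + 'i%C * ((normc (q z) ^+ 2)%:C%C - 2 * alpha ^+ 2) * p z
        - (alpha * q z + 'i%C / 2 * dC_x q z)].

(* pi is the Hermitian projection of C^2 onto the line spanned by v; the
   column space of pi is the row space of its transpose. *)
Definition herm_proj_onto (pi : 'M[C]_2) (v : 'cV[C]_2) : Prop :=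
  [/\ pi ^t* = pi, pi *m pi = pi & (pi^T == v^T)%MS].

Definition simple_factor (alpha : C) (pi : 'M[C]_2) (lambda : C) : 'M[C]_2 :=
  1%:M + ((alpha - alpha^*) / (lambda - alpha)) *: (1%:M - pi).

Definition BT_trivialization (alpha : C) (pi phi : R * R -> 'M[C]_2) :
    R * R -> 'M[C]_2 :=
  fun z => phi z *m (pi z + (alpha / alpha^*) *: (1%:M - pi z)).

Definition BT_curve (alpha : C) (p : R * R -> C) (g : R * R -> 'M[R]_3)
    (gamma : R * R -> 'cV[R]_3) : R * R -> 'cV[R]_3 :=
  fun z => gamma z +
    (Im alpha / (normc alpha ^+ 2 * (1 + normc (p z) ^+ 2))) *:
      ((1 - normc (p z) ^+ 2) *: col 0 (g z)
       + (2 * Re (p z)) *: col 1 (g z)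
       + (2 * Im (p z)) *: col 2%:R (g z)).

(* The column (w, 1)^t. *)
Definition affine_vec (w : C) : 'cV[C]_2 := mx_rows 2 1 [:: [:: w]; [:: 1]].

End BacklundTransformation.

(* Main.v *)
Require Import Defs.
From mathcomp Require Import all_boot all_order all_algebra.
From mathcomp Require Import complex.
From mathcomp Require Import all_classical all_reals all_analysis.
From mathcomp Require Import ring.

Set Implicit Arguments.
Unset Strict Implicit.
Unset Printing Implicit Defensive.

Import Order.TTheory GRing.Theory Num.Theory numFieldNormedType.Exports.

Local Open Scope ring_scope.

(* A Hermitian projection pi is encoded by the real quaternion
   X = alpha pi + conj(alpha) pi^perp = mu + V, where mu = Re alpha and V is a
   vector of R^3 = su(2) of constant length |Im alpha|, written in the moving
   frame g, whose first vector is e. With u and Q half the angular velocities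
   of the frame in x and t, if p solves BT then X solves the Lax equations
     X_x = [X, e X + u],   X_t = [X, e X^2 + u X + Q],
   and then conjugating the frame by X and adding - g V / |alpha|^2 to the curve
   produces a framed solution again, with u + [e, X] and Q - X_x in place of u
   and Q. Two solutions X1, X2 combine as follows: with Y = X1 - X2, the
   quaternion X2' = Y X2 Y^-1 is the one attached to p~_2, and it solves the Lax
   equations of the frame transformed by X1; symmetrically for X1' = Y X1 Y^-1.
   The two orders agree because of the refactorization
     X2' + X1 = X1' + X2,   X2' X1 = X1' X2,
   the two total displacements being the vector part of
   (X2' X1)^-1 (X2' + X1). *)

(** * Calculus *)

Section Calculus.
Variable R : realType.

Lemma differentiable_mxP m n (f : R * R -> 'M[R]_(m, n)) z :
  differentiable f z <-> forall i j, differentiable (fun w => f w i j) z.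
Proof.
split=> [df i j|df].
  exact: (differentiable_comp df (differentiable_coord _ i j)).
rewrite (_ : f = \sum_i \sum_j (fun w => f w i j *: delta_mx i j)).
  apply: differentiable_sum => i; apply: differentiable_sum => j.
  exact: differentiableZl.
apply/funext => w; rewrite fct_sumE [LHS]matrix_sum_delta.
by apply: eq_bigr => i _; rewrite fct_sumE.
Qed.

Lemma continuous_mxP m n (f : R * R -> 'M[R]_(m, n)) :
  continuous f <-> forall i j, continuous (fun w => f w i j).
Proof.
split=> [cf i j w|cf w].
  exact: (continuous_comp (cf w) (@coord_continuous _ _ _ i j _)).
move=> A [P HP PA]; near=> x; apply: PA => /= i j; move: i j; near: x.
apply: filter_forall => i; apply: filter_forall => j.
exact: cf (HP i j).
Unshelve. all: by end_near. Qed.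

Lemma derive_coord m n (f : R * R -> 'M[R]_(m, n)) z v i j :
  differentiable f z -> ('D_v f z) i j = 'D_v (fun w => f w i j) z.
Proof. by move=> df; rewrite derive_mx ?mxE//; exact: diff_derivable. Qed.

Lemma CkS k (V : normedModType R) (f : R * R -> V) :
  Ck k.+1 f <-> [/\ forall z, differentiable f z, Ck k (d_x f) & Ck k (d_t f)].
Proof. by []. Qed.

(** Taking an entry commutes with differentiation for a differentiable matrix function, so
    differentiability travels through the induction together with the two derivatives. *)
Lemma Ck_mxP k m n (f : R * R -> 'M[R]_(m, n)) :
  Ck k f <-> forall i j, Ck k (fun w => f w i j).
Proof.
elim: k m n f => [|k IH] m n f; first exact: continuous_mxP.
have E v : (forall z, differentiable f z) -> forall i j,
    (fun w => 'D_v f w i j) = 'D_v (fun w => f w i j).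
  by move=> df i j; apply/funext => w; exact: derive_coord.
split=> [/CkS[df fx ft] i j|H].
  apply/CkS; split; first by move=> z; move/differentiable_mxP: (df z).
  - by rewrite /d_x -(E _ df); exact ((IH _ _ _).1 fx i j).
  - by rewrite /d_t -(E _ df); exact ((IH _ _ _).1 ft i j).
have df z : differentiable f z.
  by apply/differentiable_mxP => i j; have /CkS[] := H i j.
apply/CkS; split; first exact df.
- apply/IH => i j; rewrite (E _ df).
  have /CkS[_ fx _] := H i j; exact fx.
- apply/IH => i j; rewrite (E _ df).
  have /CkS[_ _ ft] := H i j; exact ft.
Qed.

Lemma smooth_diff (V : normedModType R) (f : R * R -> V) z :
  smooth f -> differentiable f z.
Proof. by move/(_ 1) => /CkS[]. Qed.

Lemma CkW k (V : normedModType R) (f : R * R -> V) : Ck k.+1 f -> Ck k f.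
Proof.
elim: k f => [|k IH] f /CkS[df fx ft].
  by move=> z; exact: differentiable_continuous.
apply/CkS; split; first exact df.
- exact (IH _ fx).
- exact (IH _ ft).
Qed.

Lemma Ck_cst k (V : normedModType R) (c : V) : Ck k (fun _ => c).
Proof.
elim: k c => [|k IH] c; first by move=> z; exact: cst_continuous.
apply/CkS; split; first by move=> z; exact: differentiable_cst.
- rewrite (_ : d_x _ = fun _ => 0); first exact: IH.
  by apply/funext => z; exact: derive_cst.
- rewrite (_ : d_t _ = fun _ => 0); first exact: IH.
  by apply/funext => z; exact: derive_cst.
Qed.

Lemma derive_add (V : normedModType R) (f g : R * R -> V) z v :
  differentiable f z -> differentiable g z ->
  'D_v (fun w => f w + g w) z = 'D_v f z + 'D_v g z.
Proof. by move=> df dg; apply: deriveD; exact: diff_derivable. Qed.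

Lemma CkD k (V : normedModType R) (f g : R * R -> V) :
  Ck k f -> Ck k g -> Ck k (fun z => f z + g z).
Proof.
elim: k f g => [|k IH] f g.
  by move=> cf cg z; exact (cvgD (cf z) (cg z)).
move=> /CkS[df fx ft] /CkS[dg gx gt]; apply/CkS; split.
- by move=> z; exact (differentiableD (df z) (dg z)).
- rewrite (_ : d_x _ = fun z => d_x f z + d_x g z); first exact (IH _ _ fx gx).
  by apply/funext => z; exact (derive_add _ (df z) (dg z)).
- rewrite (_ : d_t _ = fun z => d_t f z + d_t g z); first exact (IH _ _ ft gt).
  by apply/funext => z; exact (derive_add _ (df z) (dg z)).
Qed.

Lemma derive_mul (f g : R * R -> R) z v :
  differentiable f z -> differentiable g z ->
  'D_v (fun w => f w * g w) z = f z * 'D_v g z + g z * 'D_v f z.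
Proof. by move=> df dg; apply: deriveM; exact: diff_derivable. Qed.

Lemma CkM k (f g : R * R -> R) :
  Ck k f -> Ck k g -> Ck k (fun z => f z * g z).
Proof.
elim: k f g => [|k IH] f g.
  by move=> cf cg z; exact (cvgM (cf z) (cg z)).
(* The product rule at order k+1 involves f and g themselves at order k, hence the weakening. *)
move=> Cf Cg; have Wf := CkW Cf; have Wg := CkW Cg.
move/CkS: Cf Cg => [df fx ft] /CkS[dg gx gt]; apply/CkS; split.
- by move=> z; exact (differentiableM (df z) (dg z)).
- rewrite (_ : d_x _ = fun z => f z * d_x g z + g z * d_x f z).
    exact (CkD (IH _ _ Wf gx) (IH _ _ Wg fx)).
  by apply/funext => z; exact (derive_mul _ (df z) (dg z)).
- rewrite (_ : d_t _ = fun z => f z * d_t g z + g z * d_t f z).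
    exact (CkD (IH _ _ Wf gt) (IH _ _ Wg ft)).
  by apply/funext => z; exact (derive_mul _ (df z) (dg z)).
Qed.

Lemma Ck_sum k n (f : 'I_n -> R * R -> R) :
  (forall i, Ck k (f i)) -> Ck k (fun z => \sum_i f i z).
Proof.
elim: n f => [|n IH] f Cf.
  by under eq_fun do rewrite big_ord0; exact: Ck_cst.
under eq_fun do rewrite big_ord_recl.
by apply: CkD; [exact: Cf|exact: IH].
Qed.

Lemma Ck_mulmx k m n p (f : R * R -> 'M[R]_(m, n)) (g : R * R -> 'M[R]_(n, p)) :
  Ck k f -> Ck k g -> Ck k (fun z => f z *m g z).
Proof.
move=> /Ck_mxP Cf /Ck_mxP Cg; apply/Ck_mxP => i j.
under eq_fun do rewrite mxE.
by apply: Ck_sum => l; exact: CkM.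
Qed.

Lemma derive_scale (V : normedModType R) (f : R * R -> V) (c : R) z v :
  differentiable f z -> 'D_v (fun w => c *: f w) z = c *: 'D_v f z.
Proof. by move=> df; apply: deriveZ; exact: diff_derivable. Qed.

Lemma CkZ k (V : normedModType R) (c : R) (f : R * R -> V) :
  Ck k f -> Ck k (fun z => c *: f z).
Proof.
elim: k f => [|k IH] f.
  by move=> cf z; apply: cvgZ; [exact: cvg_cst|exact (cf z)].
move=> /CkS[df fx ft]; apply/CkS; split.
- by move=> z; exact (differentiableZ _ (df z)).
- rewrite (_ : d_x _ = fun z => c *: d_x f z); first exact (IH _ fx).
  by apply/funext => z; exact (derive_scale _ _ (df z)).
- rewrite (_ : d_t _ = fun z => c *: d_t f z); first exact (IH _ ft).
  by apply/funext => z; exact (derive_scale _ _ (df z)).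
Qed.

Lemma CkN k (V : normedModType R) (f : R * R -> V) :
  Ck k f -> Ck k (fun z => - f z).
Proof. by move=> Cf; under eq_fun do rewrite -scaleN1r; exact: CkZ. Qed.

Lemma smooth_derive (V : normedModType R) (f : R * R -> V) :
  smooth f -> smooth (d_x f) /\ smooth (d_t f).
Proof.
by move=> Cf; split=> k; have /CkS[_ fx ft] := Cf k.+1; [exact fx|exact ft].
Qed.

(* Bootstrapping: solutions of a first-order system gain regularity. *)
Lemma smooth_bootstrap (V : normedModType R) (f : R * R -> V) :
  (forall z, differentiable f z) ->
  (forall k, Ck k f -> Ck k (d_x f)) -> (forall k, Ck k f -> Ck k (d_t f)) ->
  smooth f.
Proof.
move=> df fx ft; elim=> [|k IH]; last first.
  by apply/CkS; split; [exact df|exact (fx _ IH)|exact (ft _ IH)].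
by move=> z; exact: differentiable_continuous.
Qed.

Lemma differentiable_mulmx m n p (f : R * R -> 'M[R]_(m, n))
    (g : R * R -> 'M[R]_(n, p)) z :
  differentiable f z -> differentiable g z ->
  differentiable (fun w => f w *m g w) z.
Proof.
move=> /differentiable_mxP df /differentiable_mxP dg.
apply/differentiable_mxP => i j.
rewrite (_ : (fun w => _) = \sum_k (fun w => f w i k * g w k j)).
  by apply: differentiable_sum => k; exact: differentiableM.
by apply/funext => w; rewrite mxE fct_sumE.
Qed.

Lemma derive_mulmx m n p (f : R * R -> 'M[R]_(m, n))
    (g : R * R -> 'M[R]_(n, p)) z v :
  differentiable f z -> differentiable g z ->
  'D_v (fun w => f w *m g w) z = 'D_v f z *m g z + f z *m 'D_v g z.
Proof.
move=> df dg; apply/matrixP => i j.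
rewrite derive_coord; last exact: differentiable_mulmx.
rewrite (_ : (fun w => _) = \sum_k (fun w => f w i k * g w k j)); last first.
  by apply/funext => w; rewrite mxE fct_sumE.
have dfc := (differentiable_mxP _ _).1 df.
have dgc := (differentiable_mxP _ _).1 dg.
rewrite derive_sum; last first.
  by move=> k; apply: derivableM; exact: diff_derivable.
rewrite !mxE -big_split; apply: eq_bigr => k _ /=.
rewrite (derive_mul _ (dfc i k) (dgc k j)).
rewrite (derive_coord v i k df) (derive_coord v k j dg) addrC.
by congr (_ + _); rewrite mulrC.
Qed.

Lemma derive_opp (V : normedModType R) (f : R * R -> V) z v :
  differentiable f z -> 'D_v (fun w => - f w) z = - 'D_v f z.
Proof. by move=> df; apply: deriveN; exact: diff_derivable. Qed.

End Calculus.

(** * Vectors and rotations of R^3 *)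

Section Vectors.
Variable R : realType.
Implicit Types (u v w V Q : 'cV[R]_3) (g : 'M[R]_3).

Definition vec3 (x y z : R) : 'cV[R]_3 :=
  mx_rows 3 1 [:: [:: x]; [:: y]; [:: z]].

Lemma vec3_eta v : v = vec3 (v 0 0) (v 1 0) (v 2%:R 0).
Proof.
apply/matrixP => i j; rewrite (ord1 j) mxE.
by case: i => -[|[|[|//]]] hi /=; congr (v _ _); apply/val_inj.
Qed.

Lemma vec3P v : exists x y z, v = vec3 x y z.
Proof. by exists (v 0 0), (v 1 0), (v 2%:R 0); exact: vec3_eta. Qed.

Lemma vec3_0 x y z : vec3 x y z 0 0 = x. Proof. by rewrite mxE. Qed.
Lemma vec3_1 x y z : vec3 x y z 1 0 = y. Proof. by rewrite mxE. Qed.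
Lemma vec3_2 x y z : vec3 x y z 2%:R 0 = z. Proof. by rewrite mxE. Qed.

Definition vec3_coord := (vec3_0, vec3_1, vec3_2).

Lemma vec3D x y z x' y' z' :
  vec3 x y z + vec3 x' y' z' = vec3 (x + x') (y + y') (z + z').
Proof. by rewrite [LHS]vec3_eta ![(_ + _ : 'cV__) _ _]mxE !vec3_coord. Qed.

Lemma vec3N x y z : - vec3 x y z = vec3 (- x) (- y) (- z).
Proof. by rewrite [LHS]vec3_eta ![(- _ : 'cV__) _ _]mxE !vec3_coord. Qed.

Lemma vec3Z c x y z : c *: vec3 x y z = vec3 (c * x) (c * y) (c * z).
Proof. by rewrite [LHS]vec3_eta ![(_ *: _ : 'cV__) _ _]mxE !vec3_coord. Qed.

Lemma cross_vec3 x y z x' y' z' : cross (vec3 x y z) (vec3 x' y' z') =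
  vec3 (y * z' - z * y') (z * x' - x * z') (x * y' - y * x').
Proof. by rewrite /cross !vec3_coord. Qed.

Definition dot u v : R := u 0 0 * v 0 0 + u 1 0 * v 1 0 + u 2%:R 0 * v 2%:R 0.

Lemma dot_vec3 x y z x' y' z' :
  dot (vec3 x y z) (vec3 x' y' z') = x * x' + y * y' + z * z'.
Proof. by rewrite /dot !vec3_coord. Qed.

(** Rewriting with it turns a vector identity into equal [vec3] of explicit polynomials, so that
    [congr vec3] leaves three scalar goals. *)
Definition vec3E :=
  (vec3D, vec3N, vec3Z, cross_vec3, dot_vec3, vec3_0, vec3_1, vec3_2).

(** The cross product as a matrix, so that its calculus and the angular velocities of frames reduce
    to matrix products. *)
Definition hat v : 'M[R]_3 := mx_rows 3 3
  [:: [:: 0; - v 2%:R 0; v 1 0];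
      [:: v 2%:R 0; 0; - v 0 0];
      [:: - v 1 0; v 0 0; 0]].

Lemma hat_mul v w : hat v *m w = cross v w.
Proof.
have [x [y [z ->]]] := vec3P v; have [x' [y' [z' ->]]] := vec3P w.
rewrite [LHS]vec3_eta cross_vec3 ![(_ *m _) _ _]mxE !big_ord_recl !big_ord0.
by rewrite !mxE /=; congr vec3; ring.
Qed.

Lemma hatD v w : hat (v + w) = hat v + hat w.
Proof.
by apply/matrixP => -[[|[|[|//]]] hi] [[|[|[|//]]] hj]; rewrite !mxE /= ?mxE;
  ring.
Qed.

Lemma hatZ c v : hat (c *: v) = c *: hat v.
Proof.
by apply/matrixP => -[[|[|[|//]]] hi] [[|[|[|//]]] hj]; rewrite !mxE /= ?mxE;
  ring.
Qed.

Lemma mulmx_vecP (A B : 'M[R]_3) : (forall v, A *m v = B *m v) -> A = B.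
Proof.
move=> AB; apply/matrixP => i j.
by have /matrixP/(_ i 0) := AB (delta_mx j 0); rewrite -!colE !mxE.
Qed.

Definition axis : 'cV[R]_3 := vec3 1 0 0.

(* With X = mu + V a quaternion of squared norm N, this is v |-> X^-1 v X. *)
Definition qrot mu N V : 'M[R]_3 :=
  1%:M + N^-1 *: (2 *: (hat V *m hat V) - (2 * mu) *: hat V).

Lemma qrot_mul mu N V v :
  qrot mu N V *m v =
  v + N^-1 *: (2 *: cross V (cross V v) - (2 * mu) *: cross V v).
Proof.
by rewrite mulmxDl mul1mx -scalemxAl mulmxBl -!scalemxAl -mulmxA !hat_mul.
Qed.

Lemma col_vec3 g x y z :
  g *m vec3 x y z = x *: col 0 g + y *: col 1 g + z *: col 2%:R g.
Proof.
apply/matrixP => i j; rewrite (ord1 j) !mxE !big_ord_recl !big_ord0 !mxE /=.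
by rewrite addr0 addrA; congr (_ + _ + _); rewrite mulrC; congr (_ * g _ _);
  exact/val_inj.
Qed.

(** The property of rotations that is carried along the Backlund steps. *)
Definition cross_morph g :=
  forall v w, cross (g *m v) (g *m w) = g *m cross v w.

Lemma cross_morphM g h : cross_morph g -> cross_morph h -> cross_morph (g *m h).
Proof. by move=> Hg Hh v w; rewrite -!mulmxA Hg Hh. Qed.

Lemma crossDl u v w : cross (u + v) w = cross u w + cross v w.
Proof. by rewrite -!hat_mul hatD mulmxDl. Qed.

Lemma crossDr u v w : cross u (v + w) = cross u v + cross u w.
Proof. by rewrite -!hat_mul mulmxDr. Qed.

Lemma crossZl c u v : cross (c *: u) v = c *: cross u v.
Proof. by rewrite -!hat_mul hatZ scalemxAl. Qed.

Lemma crossZr c u v : cross u (c *: v) = c *: cross u v.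
Proof. by rewrite -!hat_mul scalemxAr. Qed.

(** Conjugation by an invertible quaternion is an algebra automorphism, so it respects the cross
    product. With [qrot] = 1 + A/N the claim reduces to the identity [AA], where N = mu^2 + |V|^2
    enters. *)
Lemma qrot_cross mu N V : N = mu ^+ 2 + dot V V -> N != 0 ->
  cross_morph (qrot mu N V).
Proof.
move=> EN N0 u v; rewrite !qrot_mul.
pose A w := 2 *: cross V (cross V w) - (2 * mu) *: cross V w.
have AA : cross (A u) (A v) =
    N *: (A (cross u v) - cross (A u) v - cross u (A v)).
  rewrite EN /A.
  have [x [y [z ->]]] := vec3P V.
  have [a [b [c ->]]] := vec3P u; have [d [e [f ->]]] := vec3P v.
  by rewrite !vec3E; congr vec3; ring.
rewrite -!/(A _) !crossDl !crossDr !crossZl !crossZr AA.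
rewrite (scalerA N^-1 N) mulVf// scale1r -addrA; congr (_ + _).
rewrite addrC -scalerDr -scalerDr; congr (_ *: _).
by rewrite [X in X + _]addrC addrAC !subrK.
Qed.

End Vectors.

(** * Calculus of cross products of moving vectors *)

Section Step.
Variable R : realType.
Implicit Types (u V Q : R * R -> 'cV[R]_3) (g : R * R -> 'M[R]_3).

Lemma Ck_hat k V : Ck k V -> Ck k (fun z => hat (V z)).
Proof.
move=> /Ck_mxP CV; apply/Ck_mxP => -[[|[|[|//]]] hi] [[|[|[|//]]] hj];
  under eq_fun do rewrite mxE /=;
  first [exact: Ck_cst | exact: CV | exact: CkN].
Qed.

Lemma differentiable_hat V z :
  differentiable V z -> differentiable (fun w => hat (V w)) z.
Proof.
move=> /differentiable_mxP dV; apply/differentiable_mxP.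
move=> -[[|[|[|//]]] hi] [[|[|[|//]]] hj];
  under eq_fun do rewrite mxE /=;
  first [exact: differentiable_cst | exact: dV | exact: differentiableN].
Qed.

Lemma derive_hat V z v : differentiable V z ->
  'D_v (fun w => hat (V w)) z = hat ('D_v V z).
Proof.
move=> dV; have dVc := (differentiable_mxP _ _).1 dV.
apply/matrixP => i j; rewrite derive_coord; last exact: differentiable_hat.
move: i j => -[[|[|[|//]]] hi] [[|[|[|//]]] hj];
  rewrite [RHS]mxE /= ?(derive_coord _ _ _ dV); under eq_fun do rewrite mxE /=;
  match goal with
  | |- _ = - _ => exact: derive_opp
  | |- _ = 0 => exact: derive_cst
  | |- _ => reflexivity
  end.
Qed.

Lemma Ck_cross k V u : Ck k V -> Ck k u -> Ck k (fun z => cross (V z) (u z)).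
Proof.
by move=> CV Cv; under eq_fun do rewrite -hat_mul; apply: Ck_mulmx => //;
  exact: Ck_hat.
Qed.

Lemma differentiable_cross V u z :
  differentiable V z -> differentiable u z ->
  differentiable (fun w => cross (V w) (u w)) z.
Proof.
move=> dV dv; under eq_fun do rewrite -hat_mul.
by apply: differentiable_mulmx => //; exact: differentiable_hat.
Qed.

Lemma derive_cross V u z h : differentiable V z -> differentiable u z ->
  'D_h (fun w => cross (V w) (u w)) z =
  cross ('D_h V z) (u z) + cross (V z) ('D_h u z).
Proof.
move=> dV dv; under eq_fun do rewrite -hat_mul.
rewrite derive_mulmx//; last exact: differentiable_hat.
by rewrite derive_hat// !hat_mul.
Qed.

End Step.

(** * Pointwise algebra of one Backlund step *)

Section StepAlgebra.
Variable R : realType.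
Implicit Types (u v w V Vx Q : 'cV[R]_3) (mu N : R).

Local Notation e := (axis R).

Definition riccati_x mu u V := 2 *: cross V u + (2 * mu) *: cross V e
  + 2 *: cross (cross V e) V.

(** From X_x = [X, e X + u] the t-equation becomes X_t = X_x X + [X, Q]; this is its vector part,
    with X_x passed as [Vx]. *)
Definition riccati_t mu Q V Vx := 2 *: cross V Q + mu *: Vx + cross Vx V.

Definition dress V u := u + 2 *: cross e V.

(** For N = mu^2 + |V|^2 this is N (X^-1 w X - w); clearing N keeps the identities below
    polynomial. *)
Let A mu V w := 2 *: cross V (cross V w) - (2 * mu) *: cross V w.

(** The x-derivative of the new curve is g applied to the left side. The terms in u cancel, and what
    is left is the rotated tangent. *)
Lemma qrot_axis mu N u V :
  e - N^-1 *: (riccati_x mu u V + 2 *: cross u V) = qrot mu N V *m e.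
Proof.
rewrite qrot_mul -scalerN; congr (_ + _ *: _).
rewrite /riccati_x /axis; have [x [y [z ->]]] := vec3P V.
by have [a [b [c ->]]] := vec3P u; rewrite !vec3E; congr vec3; ring.
Qed.

(** The same in t. The terms in Q cancel, leaving u - X_x X / N. As X_x is orthogonal to V, X_x X /
    N = X^-1 X_x, and the Lax equation turns u - X^-1 X_x into X^-1 (u + [e, X]) X. *)
Lemma qrot_dress mu N u V Q : N = mu ^+ 2 + dot V V -> N != 0 ->
  let Vx := riccati_x mu u V in
  u - N^-1 *: (riccati_t mu Q V Vx + 2 *: cross Q V) =
  qrot mu N V *m dress V u.
Proof.
move=> EN N0 Vx; rewrite qrot_mul -/(A mu V (dress V u)).
have K : A mu V (dress V u) =
    - (riccati_t mu Q V Vx + 2 *: cross Q V) - N *: (2 *: cross e V).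
  rewrite EN /Vx /A /riccati_t /riccati_x /dress /axis.
  have [x [y [z ->]]] := vec3P V; have [a [b [c ->]]] := vec3P u.
  have [d [f [g ->]]] := vec3P Q.
  by rewrite !vec3E; congr vec3; ring.
rewrite K scalerBr (scalerA N^-1 N) mulVf// scale1r.
by rewrite scalerN addrA /dress addrAC addrK.
Qed.

(** Gauge law for the angular velocity when the frame is multiplied by [qrot], W being the
    derivative of V. Testing on vectors and clearing N reduces it to a polynomial identity. *)
Lemma qrot_intertwine mu N u u' V W : N != 0 ->
  (forall v, 2 *: cross u (A mu V v)
     + 2 *: (cross W (cross V v) + cross V (cross W v))
     - (2 * mu) *: cross W v - A mu V (2 *: cross u' v) =
     N *: (2 *: cross u' v - 2 *: cross u v)) ->
  hat (2 *: u) *m qrot mu N V + N^-1 *: (2 *: (hat W *m hat V + hat V *m hat W)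
    - (2 * mu) *: hat W) = qrot mu N V *m hat (2 *: u').
Proof.
move=> N0 K; apply: mulmx_vecP => v; move/(_ v): K => K.
rewrite mulmxDl -!mulmxA !qrot_mul !hat_mul crossDr crossZr !crossZl.
rewrite -scalemxAl mulmxBl -!scalemxAl mulmxDl -!mulmxA !hat_mul.
rewrite -!/(A _ _ _); rewrite -addrA -scalerDr.
have -> : 2 *: cross u (A mu V v) + (2 *: (cross W (cross V v)
    + cross V (cross W v)) - (2 * mu) *: cross W v) =
    A mu V (2 *: cross u' v) + N *: (2 *: cross u' v - 2 *: cross u v).
  by rewrite -K [RHS]addrC subrK addrA.
rewrite scalerDr scalerA mulVf// scale1r.
by rewrite addrCA [X in _ + X]addrC subrK addrC.
Qed.

(** In quaternions the new half velocity is X u X^-1 - X_x X^-1, and the Lax equation simplifies it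
    to u + [e, X]. *)
Lemma qrot_x mu N u V : N = mu ^+ 2 + dot V V -> N != 0 ->
  let W := riccati_x mu u V in
  hat (2 *: u) *m qrot mu N V + N^-1 *: (2 *: (hat W *m hat V + hat V *m hat W)
    - (2 * mu) *: hat W) = qrot mu N V *m hat (2 *: dress V u).
Proof.
move=> EN N0 W; apply: qrot_intertwine => // v.
rewrite EN /W /A /riccati_x /dress /axis.
have [x [y [z ->]]] := vec3P V; have [a [b [c ->]]] := vec3P u.
have [d [f [g ->]]] := vec3P v.
by rewrite !vec3E; congr vec3; ring.
Qed.

(* [riccati_x] is orthogonal to [V], hence of the form [V x s]. *)
Lemma riccati_x_cross mu u V : exists s, riccati_x mu u V = cross V s.
Proof.
exists (2 *: u + (2 * mu) *: e - 2 *: cross V e).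
rewrite /riccati_x /axis; have [x [y [z ->]]] := vec3P V.
by have [a [b [c ->]]] := vec3P u; rewrite !vec3E; congr vec3; ring.
Qed.

(** Here X Q X^-1 - X_t X^-1 = Q - X_x, because X_t = X_x X + [X, Q]. *)
Lemma qrot_t mu N u V Q : N = mu ^+ 2 + dot V V -> N != 0 ->
  let Vx := riccati_x mu u V in
  let W := riccati_t mu Q V Vx in
  hat (2 *: Q) *m qrot mu N V + N^-1 *: (2 *: (hat W *m hat V + hat V *m hat W)
    - (2 * mu) *: hat W) = qrot mu N V *m hat (2 *: (Q - Vx)).
Proof.
move=> EN N0 Vx W; apply: qrot_intertwine => // v.
(* Writing X_x as [cross V s] builds its orthogonality to V into the coordinates and removes u from
   the polynomial identity. *)
rewrite EN /W /Vx /A /riccati_t; have [s ->] := riccati_x_cross mu u V.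
have [x [y [z ->]]] := vec3P V; have [a [b [c ->]]] := vec3P s.
have [d [f [g ->]]] := vec3P v; have [k [l [m ->]]] := vec3P Q.
by rewrite !vec3E; congr vec3; ring.
Qed.

Lemma dot_axis_dress u V : dot e u = 0 -> dot e (dress V u) = 0.
Proof.
rewrite /dress /axis; have [x [y [z ->]]] := vec3P V.
have [a [b [c ->]]] := vec3P u.
by rewrite !vec3E => H; rewrite -[RHS]H; ring.
Qed.

Lemma cross_cross_axis u : dot e u = 0 ->
  2^-1 *: cross e (2 *: cross u e) = u.
Proof.
rewrite /axis; have [a [b [c ->]]] := vec3P u.
by rewrite !vec3E mul1r !mul0r !addr0 => ->; congr vec3; field.
Qed.

End StepAlgebra.

(** * Framed curves and one Backlund step *)

Section Framed.
Variable R : realType.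
Implicit Types (gamma u V Q : R * R -> 'cV[R]_3) (g : R * R -> 'M[R]_3).

Local Notation e := (axis R).

(** What an adapted p-frame provides, in a form stable under a Backlund step: the velocities u and Q
    need not come from curvatures, and gamma_t = g u stands for the VFE. *)
Record framed gamma g u Q : Prop := Framed {
  framed_curve : smooth gamma;
  framed_frame : smooth g;
  framed_u : smooth u;
  framed_Q : smooth Q;
  framed_dx : forall z, d_x gamma z = g z *m e;
  framed_dt : forall z, d_t gamma z = g z *m u z;
  framed_gx : forall z, d_x g z = g z *m hat (2 *: u z);
  framed_gt : forall z, d_t g z = g z *m hat (2 *: Q z);
  framed_perp : forall z, dot e (u z) = 0;
  framed_cross : forall z, cross_morph (g z) }.

(** X = mu + V solves both Lax equations and has constant squared norm N. *)
Record backlund mu N u Q V : Prop := Backlund {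
  backlund_smooth : smooth V;
  backlund_norm : forall z, N = mu ^+ 2 + dot (V z) (V z);
  backlund_dx : forall z, d_x V z = riccati_x mu (u z) (V z);
  backlund_dt : forall z, d_t V z = riccati_t mu (Q z) (V z) (d_x V z) }.

(** Since gamma_xx = g_x e is g applied to [cross (2 *: u) e], the VFE amounts to e cross (u cross
    e) = u, true for u orthogonal to the unit vector e. *)
Lemma framed_VFE gamma g u Q : framed gamma g u Q -> VFE_solution gamma.
Proof.
case=> sgamma sg su sQ gx gt ggx ggt u0 gc; split=> // z.
have -> : d_x gamma = fun z => g z *m e by apply/funext.
rewrite /d_x derive_mulmx; [|exact: smooth_diff|exact: differentiable_cst].
rewrite derive_cst mulmx0 addr0 -/(d_x g z) ggx gt -mulmxA hat_mul.
by rewrite gc scalemxAr crossZl cross_cross_axis.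
Qed.

(** The right-hand sides are polynomial in V, V_x, u and Q, so differentiability of V bootstraps to
    smoothness. *)
Lemma backlund_of_diff mu N u Q V : smooth u -> smooth Q ->
  (forall z, differentiable V z) ->
  (forall z, N = mu ^+ 2 + dot (V z) (V z)) ->
  (forall z, d_x V z = riccati_x mu (u z) (V z)) ->
  (forall z, d_t V z = riccati_t mu (Q z) (V z) (d_x V z)) ->
  backlund mu N u Q V.
Proof.
move=> su sQ dV EN Vx Vt; split=> //.
have H k : Ck k V -> Ck k (d_x V).
  move=> CV; rewrite (_ : d_x V = fun z => riccati_x mu (u z) (V z)).
    have Ce : Ck k (fun=> e) by exact: Ck_cst.
    have CVe : Ck k (fun z => cross (V z) e) by exact: Ck_cross.
    have CVu : Ck k (fun z => cross (V z) (u z)).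
      by apply: Ck_cross => //; exact: su.
    apply: CkD; [apply: CkD|]; apply: CkZ => //; exact: Ck_cross.
  by apply/funext.
apply: smooth_bootstrap; [exact: dV|exact: H|move=> k CV].
rewrite (_ : d_t V = fun z => riccati_t mu (Q z) (V z) (d_x V z)).
  have CVQ : Ck k (fun z => cross (V z) (Q z)).
    by apply: Ck_cross => //; exact: sQ.
  apply: CkD; [apply: CkD; apply: CkZ; [exact: CVQ|exact: H]|].
  by apply: Ck_cross => //; exact: H.
by apply/funext.
Qed.

(** The normalization N is a constant, so only [hat V] and its square are differentiated. *)
Lemma derive_qrot mu N V z h : differentiable V z ->
  'D_h (fun w => qrot mu N (V w)) z =
  N^-1 *: (2 *: (hat ('D_h V z) *m hat (V z) + hat (V z) *m hat ('D_h V z))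
    - (2 * mu) *: hat ('D_h V z)).
Proof.
move=> dV; have dH := differentiable_hat dV.
have dHH := differentiable_mulmx dH dH.
have d2 := differentiableZ 2 dHH.
have d3 := differentiableZ (2 * mu) dH.
have d4 := differentiableN d3.
rewrite /qrot derive_add; last 2 first.
- exact: differentiable_cst.
- by apply: differentiableZ; exact: differentiableD.
rewrite derive_cst add0r derive_scale; last exact: differentiableD.
rewrite derive_add// derive_opp// !derive_scale// derive_mulmx//.
by rewrite derive_hat.
Qed.

(** The transformed data satisfy the same equations, which is what allows a second step. *)
Lemma framed_step gamma g u Q mu N V : N != 0 ->
  framed gamma g u Q -> backlund mu N u Q V ->
  framed (fun z => gamma z - N^-1 *: (g z *m V z))
    (fun z => g z *m qrot mu N (V z)) (fun z => dress (V z) (u z))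
    (fun z => Q z - d_x V z).
Proof.
move=> N0 [sgamma sg su sQ gx gt ggx ggt u0 gc] [sV EN Vx Vt].
have dV z := smooth_diff z sV; have dg z := smooth_diff z sg.
have dgamma z := smooth_diff z sgamma.
have sH : smooth (fun z => hat (V z)) by move=> k; exact: Ck_hat.
have sR : smooth (fun z => qrot mu N (V z)).
  move=> k; apply: CkD; first exact: Ck_cst.
  apply: CkZ; apply: CkD; last by apply: CkN; apply: CkZ; exact: sH.
  by apply: CkZ; apply: Ck_mulmx; exact: sH.
have DG z h : 'D_h (fun z => gamma z - N^-1 *: (g z *m V z)) z =
    'D_h gamma z - N^-1 *: ('D_h g z *m V z + g z *m 'D_h V z).
  have dgV : differentiable (fun z => g z *m V z) z.
    exact: differentiable_mulmx.
  have dn := differentiableZ N^-1 dgV.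
  rewrite derive_add//; last exact: differentiableN.
  by rewrite derive_opp// derive_scale// derive_mulmx.
have DR z h : 'D_h (fun z => g z *m qrot mu N (V z)) z =
    'D_h g z *m qrot mu N (V z) + g z *m 'D_h (fun z => qrot mu N (V z)) z.
  rewrite derive_mulmx; [by []|exact: dg|exact: (smooth_diff z sR)].
(* Expands g applied to the left sides of [qrot_axis] and [qrot_dress], with the terms in the order
   given by the product rule. *)
have E z x a b : g z *m (x - N^-1 *: (a + b)) =
    g z *m x - N^-1 *: (g z *m b + g z *m a).
  by rewrite mulmxBr -scalemxAr mulmxDr [X in _ *: X]addrC.
split.
- move=> k; apply: CkD; first exact: sgamma.
  by apply: CkN; apply: CkZ; apply: Ck_mulmx; [exact: sg|exact: sV].
- by move=> k; apply: Ck_mulmx; [exact: sg|exact: sR].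
- move=> k; apply: CkD; first exact: su.
  by apply: CkZ; apply: Ck_cross; [exact: Ck_cst|exact: sV].
- move=> k; apply: CkD; first exact: sQ.
  by apply: CkN; have [sVx _] := smooth_derive sV; exact: sVx.
- move=> z; rewrite {1}/d_x DG -!/(d_x _ z) gx ggx Vx -!mulmxA.
  by rewrite -(qrot_axis _ _ (u z)) E hat_mul crossZl.
- move=> z; rewrite {1}/d_t DG -!/(d_t _ z) gt ggt Vt Vx -!mulmxA.
  by rewrite -(qrot_dress (u z) (Q z) (EN z) N0) E hat_mul crossZl.
- move=> z; rewrite {1}/d_x DR derive_qrot// -!/(d_x _ z) ggx Vx -!mulmxA.
  by rewrite -(qrot_x (u z) (EN z) N0) mulmxDr.
- move=> z; rewrite {1}/d_t DR derive_qrot// -!/(d_t _ z) ggt Vt -!mulmxA.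
  by rewrite Vx -(qrot_t (u z) (Q z) (EN z) N0) mulmxDr.
- by move=> z; exact: dot_axis_dress.
- by move=> z; apply: cross_morphM => //; exact: qrot_cross.
Qed.

End Framed.

(** * Quaternions and the second step *)

Section NoncommutativeAlgebra.
Variable A : nzRingType.
Implicit Types X Y Z B : A.

(** Gauge covariance of Lax equations: if Y intertwines B and B', conjugation by Y carries dX =
    [X, B] to dX' = [X', B']. Derivatives are plain ring elements tied by the Leibniz relation for
    X' Y = Y X. *)
Lemma conjugate_derivation X X' Y Z B B' dX dX' dY :
  X' * Y = Y * X -> dX = X * B - B * X -> dY = Y * B - B' * Y ->
  dX' * Y + X' * dY = dY * X + Y * dX -> Y * Z = 1 ->
  dX' = X' * B' - B' * X'.
Proof.
move=> XY EX EY /(canRL (addrK _)) E YZ.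
rewrite -[LHS]mulr1 -[RHS]mulr1 -YZ !mulrA; congr (_ * Z).
rewrite E EY EX !mulrBl !mulrBr !mulrA XY -[B' * X' * Y]mulrA XY !mulrA opprB.
by rewrite [X in X + _ = _]addrC subrKA addrC subrKA.
Qed.

(** Conjugation by Y fixes Y = X1 - X2, so X1' - X2' = Y too, which gives the sums. Then X2' X1 =
    X1' X1 - Y X1 = X1' (X1 - Y) = X1' X2. *)
Lemma refactorization X1 X2 X1' X2' Y Z :
  Y = X1 - X2 -> X1' * Y = Y * X1 -> X2' * Y = Y * X2 -> Y * Z = 1 ->
  X2' + X1 = X1' + X2 /\ X2' * X1 = X1' * X2.
Proof.
move=> EY E1 E2 YZ.
have D : X1' - X2' = Y.
  rewrite -[LHS]mulr1 -[RHS]mulr1 -YZ !mulrA; congr (_ * Z).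
  by rewrite mulrBl E1 E2 -mulrBr -EY.
have D' : X2' = X1' - Y by rewrite -D opprB addrC subrK.
split; first by rewrite D' EY opprB addrA subrK.
rewrite D' mulrBl -E1; apply/eqP; rewrite -subr_eq0 addrAC -mulrBr -EY.
by rewrite subrr.
Qed.

End NoncommutativeAlgebra.

(** * Quaternions as complex 2 by 2 matrices *)

Section Quaternions.
Local Open Scope sesquilinear_scope.
Variable R : realType.
Local Notation C := R[i].
Implicit Types (m n mu N : R) (u v w V Q : 'cV[R]_3).
Local Notation e := (axis R).

(* The matrix of m + v_0 a - v_1 c + v_2 b, the basis being delta. *)
Definition quat m v : 'M[C]_2 := mx_rows 2 2
  [:: [:: Complex m (v 0 0); Complex (v 2%:R 0) (- v 1 0)];
      [:: Complex (- v 2%:R 0) (- v 1 0); Complex m (- v 0 0)]].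

Lemma quatD m n v w : quat m v + quat n w = quat (m + n) (v + w).
Proof.
apply: mx2P; rewrite !mxE /= ?mxE; apply/eqP; rewrite eq_complex /=;
  apply/andP; split; apply/eqP; ring.
Qed.

Lemma quatZ c m v : c%:C%C *: quat m v = quat (c * m) (c *: v).
Proof.
apply: mx2P; rewrite !mxE /= ?mxE; apply/eqP; rewrite eq_complex /=;
  apply/andP; split; apply/eqP; ring.
Qed.

Lemma quatN m v : - quat m v = quat (- m) (- v).
Proof.
apply: mx2P; rewrite !mxE /= ?mxE; apply/eqP; rewrite eq_complex /=;
  apply/andP; split; apply/eqP; ring.
Qed.

Lemma quatB m n v w : quat m v - quat n w = quat (m - n) (v - w).
Proof. by rewrite quatN quatD. Qed.

Lemma quatM m n v w :
  quat m v * quat n w = quat (m * n - dot v w) (m *: w + n *: v + cross v w).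
Proof.
have [x [y [z ->]]] := vec3P v; have [a [b [c ->]]] := vec3P w.
rewrite !vec3E -mulmxE.
apply: mx2P; rewrite !mxE !big_ord_recl !big_ord0 !mxE /=;
  apply/eqP; rewrite eq_complex /=; apply/andP; split; apply/eqP; ring.
Qed.

Lemma quat1 : quat 1 0 = 1.
Proof. by apply: mx2P; rewrite !mxE /= ?mxE ?oppr0. Qed.

Lemma quat_inj m n v w : quat m v = quat n w -> m = n /\ v = w.
Proof.
move=> /matrixP E; have [-> v0] : m = n /\ v 0 0 = w 0 0.
  have := E 0 0; rewrite !mxE /= => -[em ev]; split; [exact: em|exact: ev].
have [v2 v1] : v 2%:R 0 = w 2%:R 0 /\ v 1 0 = w 1 0.
  have := E 0 1; rewrite !mxE /= => -[ea /oppr_inj eb].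
  split; [exact: ea|exact: eb].
by split=> //; rewrite [v]vec3_eta [w]vec3_eta v0 v1 v2.
Qed.

Lemma quat_tr m v : (quat m v)^t* = quat m (- v).
Proof.
by apply: mx2P; rewrite !mxE /= ?mxE; apply/eqP; rewrite eq_complex /= ?opprK
  !eqxx.
Qed.

Lemma dotNl v w : dot (- v) w = - dot v w.
Proof. by rewrite /dot !mxE; ring. Qed.

Lemma dotNr v w : dot v (- w) = - dot v w.
Proof. by rewrite /dot !mxE; ring. Qed.

Lemma crossvv v : cross v v = 0.
Proof.
have [x [y [z ->]]] := vec3P v; rewrite vec3E -[0](scale0r (vec3 1 1 1)) vec3E.
by congr vec3; ring.
Qed.

Lemma quatVl m N v : N = m ^+ 2 + dot v v -> N != 0 ->
  quat (N^-1 * m) (N^-1 *: - v) * quat m v = 1.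
Proof.
move=> EN N0; rewrite -quatZ -scalerAl quatM dotNl opprK -expr2 -EN.
rewrite scalerN subrr add0r -scaleN1r crossZl crossvv scaler0 quatZ mulVf//.
by rewrite scaler0 quat1.
Qed.

Lemma quatVr m N v : N = m ^+ 2 + dot v v -> N != 0 ->
  quat m v * quat (N^-1 * m) (N^-1 *: - v) = 1.
Proof.
move=> EN N0; rewrite -quatZ -scalerAr quatM dotNr opprK -expr2 -EN.
rewrite scalerN addNr add0r -scaleN1r crossZr crossvv scaler0 quatZ mulVf//.
by rewrite scaler0 quat1.
Qed.

(** This is X (X^-1 v X) = v X: [qrot] is conjugation by X^-1. *)
Lemma quat_qrot mu N V v : N = mu ^+ 2 + dot V V -> N != 0 ->
  quat mu V * quat 0 (qrot mu N V *m v) = quat 0 v * quat mu V.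
Proof.
move=> EN N0; rewrite qrot_mul.
rewrite -[quat 0 (v + _)](_ : quat 0 v + N^-1%:C%C *:
  quat 0 (2 *: cross V (cross V v) - (2 * mu) *: cross V v) = _); last first.
  by rewrite quatZ quatD mulr0 addr0.
rewrite mulrDr -scalerAr.
have -> : quat mu V * quat 0 (2 *: cross V (cross V v) - (2 * mu) *: cross V v)
    = N%:C%C *: (quat 0 v * quat mu V - quat mu V * quat 0 v).
  rewrite EN !quatM quatB quatZ.
  have [x [y [z ->]]] := vec3P V; have [a [b [c ->]]] := vec3P v.
  by rewrite !vec3E; congr quat; [ring|congr vec3; ring].
rewrite scalerA -rmorphM/= mulVf// scale1r addrC subrK//.
Qed.

(* In terms of X = mu + V, the Riccati equations are Lax equations
   X_x = [X, e X + u] and X_t = [X, e X^2 + u X + Q]. *)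
Definition laxA u (X : 'M[C]_2) : 'M[C]_2 := quat 0 e * X + quat 0 u.

Definition laxB u Q (X : 'M[C]_2) : 'M[C]_2 :=
  quat 0 e * X * X + quat 0 u * X + quat 0 Q.

Lemma quat_riccati_x mu u V :
  let X := quat mu V in
  quat 0 (riccati_x mu u V) = X * laxA u X - laxA u X * X.
Proof.
rewrite /laxA /riccati_x /axis.
have [x [y [z ->]]] := vec3P V; have [a [b [c ->]]] := vec3P u.
rewrite !(quatM, quatD, quatB, vec3E).
by congr quat; [ring|congr vec3; ring].
Qed.

Lemma quat_riccati_t mu u Q V :
  let X := quat mu V in
  quat 0 (riccati_t mu Q V (riccati_x mu u V)) =
  X * laxB u Q X - laxB u Q X * X.
Proof.
rewrite /laxB /riccati_t /riccati_x /axis.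
have [x [y [z ->]]] := vec3P V; have [a [b [c ->]]] := vec3P u.
have [d [f [g ->]]] := vec3P Q.
rewrite !(quatM, quatD, quatB, vec3E).
by congr quat; [ring|congr vec3; ring].
Qed.

(** When X2' Y = Y X2, the subtracted term is (e X2' + u') Y with u' the dressed u, so Y intertwines
    the Lax matrices of X2 and X2'. Written with Y X2, the identity is polynomial. *)
Lemma difference_x mu1 mu2 u V1 V2 :
  let X2 := quat mu2 V2 in let Y := quat (mu1 - mu2) (V1 - V2) in
  quat 0 (riccati_x mu1 u V1 - riccati_x mu2 u V2) =
  Y * laxA u X2 - (quat 0 e * Y * X2 + quat 0 (dress V1 u) * Y).
Proof.
rewrite /laxA /riccati_x /dress /axis.
have [x [y [z ->]]] := vec3P V1; have [a [b [c ->]]] := vec3P u.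
have [d [f [g ->]]] := vec3P V2.
rewrite !(quatM, quatD, quatB, vec3E).
by congr quat; [ring|congr vec3; ring].
Qed.

(** The subtracted term is likewise (e X2'^2 + u' X2' + Q') Y, where Q' = Q - (V1)_x. *)
Lemma difference_t mu1 mu2 u Q V1 V2 :
  let X2 := quat mu2 V2 in let Y := quat (mu1 - mu2) (V1 - V2) in
  quat 0 (riccati_t mu1 Q V1 (riccati_x mu1 u V1) -
    riccati_t mu2 Q V2 (riccati_x mu2 u V2)) =
  Y * laxB u Q X2 - (quat 0 e * Y * X2 * X2 + quat 0 (dress V1 u) * Y * X2
    + quat 0 (Q - riccati_x mu1 u V1) * Y).
Proof.
rewrite /laxB /riccati_t /riccati_x /dress /axis.
have [x [y [z ->]]] := vec3P V1; have [a [b [c ->]]] := vec3P u.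
have [d [f [g ->]]] := vec3P V2; have [k [l [m ->]]] := vec3P Q.
rewrite !(quatM, quatD, quatB, vec3E).
by congr quat; [ring|congr vec3; ring].
Qed.

End Quaternions.

(** * The second Backlund step, by conjugation with Y = X1 - X2 *)

Section Iteration.
Variable R : realType.
Implicit Types (u V Q : R * R -> 'cV[R]_3).

Lemma differentiable_dot V u z : differentiable V z -> differentiable u z ->
  differentiable (fun w => dot (V w) (u w)) z.
Proof.
move=> /differentiable_mxP dV /differentiable_mxP du.
by apply: differentiableD; [apply: differentiableD|]; exact: differentiableM.
Qed.

Lemma derive_dot V u z h : differentiable V z -> differentiable u z ->
  'D_h (fun w => dot (V w) (u w)) z =
  dot ('D_h V z) (u z) + dot (V z) ('D_h u z).
Proof.
move=> dV du.
have dVc := (differentiable_mxP _ _).1 dV; have duc :=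
  (differentiable_mxP _ _).1 du.
have dM i : differentiable (fun w => V w i 0 * u w i 0) z.
  exact: differentiableM.
have dD := differentiableD (dM 0) (dM 1).
have P i : 'D_h (fun w => V w i 0 * u w i 0) z =
    V z i 0 * ('D_h u z) i 0 + u z i 0 * ('D_h V z) i 0.
  by rewrite (derive_mul h (dVc i 0) (duc i 0)) (derive_coord h i 0 dV)
    (derive_coord h i 0 du).
rewrite {1}/dot (derive_add h dD (dM 2%:R)) (derive_add h (dM 0) (dM 1)) !P.
by rewrite /dot; ring.
Qed.

Lemma differentiable_scale_fun (c : R * R -> R) V z :
  differentiable c z -> differentiable V z ->
  differentiable (fun w => c w *: V w) z.
Proof.
move=> dc /differentiable_mxP dV; apply/differentiable_mxP => i j.
by under eq_fun do rewrite mxE; exact: differentiableM.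
Qed.

(** Solves X' Y = Y X for the vector part of X'. As Y^-1 is the conjugate quaternion divided by m,
    conjugation by Y is [qrot] at that conjugate. *)
Lemma conjugate_vec y0 mu (Yv v v' : 'cV[R]_3) :
  let m := y0 ^+ 2 + dot Yv Yv in m != 0 ->
  quat mu v' * quat y0 Yv = quat y0 Yv * quat mu v ->
  v' = qrot y0 m (- Yv) *m v.
Proof.
move=> m m0 E.
have EN : m = y0 ^+ 2 + dot (- Yv) (- Yv) by rewrite dotNl dotNr opprK.
have YZ : quat y0 Yv * quat y0 (- Yv) = m%:C%C *: 1.
  rewrite quatM dotNr opprK -expr2 scalerN addNr add0r -scaleN1r.
  by rewrite crossZr crossvv scaler0 -quat1 quatZ scaler0 mulr1.
have E0 : quat y0 (- Yv) * quat 0 v' = quat 0 v * quat y0 (- Yv).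
  (* The two scalar parts agree and are central, so they cancel. *)
  have : quat 0 v' * quat y0 Yv = quat y0 Yv * quat 0 v.
    have D w : quat 0 w = quat mu w - quat mu 0 by rewrite quatB subrr subr0.
    have Cc : quat mu 0 * quat y0 Yv = quat y0 Yv * quat mu 0.
      rewrite -(mulr1 mu) -(scaler0 _ mu) -quatZ quat1 -scalerAl -scalerAr.
      by rewrite mul1r mulr1.
    by rewrite !D mulrBl mulrBr E Cc.
  move/(congr1 (fun x => quat y0 (- Yv) * x * quat y0 (- Yv))).
  have ZY : quat y0 (- Yv) * quat y0 Yv = m%:C%C *: 1.
    rewrite quatM dotNl opprK -expr2 scalerN subrr add0r -scaleN1r.
    by rewrite crossZl crossvv scaler0 -quat1 quatZ scaler0 mulr1.
  rewrite !mulrA ZY -!mulrA YZ -!scalerAl -!scalerAr !mul1r !mulr1.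
  by apply: scalerI; rewrite fmorph_eq0.
have := quat_qrot v EN m0; rewrite -E0 => /(congr1 (fun x => quat y0 Yv * x)).
rewrite !mulrA YZ -!scalerAl !mul1r.
have mC : m%:C%C != 0 by rewrite fmorph_eq0.
by move/(scalerI mC)/quat_inj => [_ ->].
Qed.

(* The hypotheses are the derivatives of the scalar and vector parts of the
   relation X' Y = Y X. *)
Lemma quat_leibniz mu y0 (v v' y dv dv' dy : 'cV[R]_3) :
  dot dv' y + dot v' dy = dot dy v + dot y dv ->
  mu *: dy + y0 *: dv' + (cross dv' y + cross v' dy) =
    y0 *: dv + mu *: dy + (cross dy v + cross y dv) ->
  quat 0 dv' * quat y0 y + quat mu v' * quat 0 dy =
  quat 0 dy * quat mu v + quat y0 y * quat 0 dv.
Proof.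
move=> Dd Df; rewrite !quatM !quatD !mulr0 !mul0r !sub0r -!opprD Dd; congr quat.
rewrite !scale0r !addr0 !add0r.
by rewrite addrACA [X in X + _ = _]addrC Df [X in X + _ = _]addrC addrACA.
Qed.

(** [difference_x] and [difference_t] say that Y intertwines the Lax matrices of the original frame
    and of the frame transformed by X1; [conjugate_derivation] then applies. *)
Lemma backlund_iterate mu1 N1 mu2 N2 u Q V1 V2 V : smooth u -> smooth Q ->
  backlund mu1 N1 u Q V1 -> backlund mu2 N2 u Q V2 ->
  (forall z, (mu1 - mu2) ^+ 2 + dot (V1 z - V2 z) (V1 z - V2 z) != 0) ->
  (forall z, quat mu2 (V z) * quat (mu1 - mu2) (V1 z - V2 z) =
     quat (mu1 - mu2) (V1 z - V2 z) * quat mu2 (V2 z)) ->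
  (forall z, N2 = mu2 ^+ 2 + dot (V z) (V z)) ->
  backlund mu2 N2 (fun z => dress (V1 z) (u z)) (fun z => Q z - d_x V1 z) V.
Proof.
move=> su sQ [s1 E1 x1 t1] [s2 E2 x2 t2] m0 EV EN.
have d1 z := smooth_diff z s1; have d2 z := smooth_diff z s2.
set Y := fun z => V1 z - V2 z.
have dY z : differentiable Y z.
  by apply: differentiableD => //; exact: differentiableN.
have DY z h : 'D_h Y z = 'D_h V1 z - 'D_h V2 z.
  by rewrite derive_add ?derive_opp//; exact: differentiableN.
have dV z : differentiable V z.
  (* V is given only implicitly by X2' Y = Y X2. Solved by [conjugate_vec], it is rational in
     differentiable data with nonvanishing denominator. *)
  rewrite (_ : V = fun z => V2 z + ((mu1 - mu2) ^+ 2 + dot (Y z) (Y z))^-1 *: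
     (2 *: cross (- Y z) (cross (- Y z) (V2 z))
      - (2 * (mu1 - mu2)) *: cross (- Y z) (V2 z))).
    have dN := differentiableN (dY z).
    have dC1 : differentiable (fun z => cross (- Y z) (V2 z)) z.
      exact: differentiable_cross.
    have dC2 := differentiable_cross dN dC1.
    apply: differentiableD => //; apply: differentiable_scale_fun.
      apply: differentiableV; last exact: m0.
      apply: differentiableD; first exact: differentiable_cst.
      exact: differentiable_dot.
    apply: differentiableD; first exact: differentiableZ.
    by apply: differentiableN; exact: differentiableZ.
  by apply/funext => w; rewrite -qrot_mul; exact: conjugate_vec (m0 w) (EV w).
(* The derivative of X2' Y = Y X2, obtained from its scalar and vector parts, which are real. *)
have DE z h : quat 0 ('D_h V z) * quat (mu1 - mu2) (Y z) +
    quat mu2 (V z) * quat 0 ('D_h Y z) =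
    quat 0 ('D_h Y z) * quat mu2 (V2 z) +
    quat (mu1 - mu2) (Y z) * quat 0 ('D_h V2 z).
  pose f w := mu2 *: Y w + (mu1 - mu2) *: V w + cross (V w) (Y w).
  pose k w := (mu1 - mu2) *: V2 w + mu2 *: Y w + cross (Y w) (V2 w).
  have Ef : f = k.
    by apply/funext => w; have := EV w; rewrite !quatM => /quat_inj[].
  have Ed : (fun w => dot (V w) (Y w)) = (fun w => dot (Y w) (V2 w)).
    apply/funext => w; have := EV w; rewrite !quatM => /quat_inj[+ _].
    by rewrite [mu2 * _]mulrC => /addrI/oppr_inj.
  have Dd : dot ('D_h V z) (Y z) + dot (V z) ('D_h Y z) =
      dot ('D_h Y z) (V2 z) + dot (Y z) ('D_h V2 z).
    rewrite -(derive_dot h (dV z) (dY z)) -(derive_dot h (dY z) (d2 z)).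
    by congr ('D_h _ z).
  have DL c c' (F G H K : R * R -> 'cV[R]_3) : differentiable F z ->
      differentiable G z -> differentiable H z -> differentiable K z ->
      'D_h (fun w => c *: F w + c' *: G w + cross (H w) (K w)) z =
      c *: 'D_h F z + c' *: 'D_h G z
      + (cross ('D_h H z) (K z) + cross (H z) ('D_h K z)).
    move=> dF dG dH dK; have dcF := differentiableZ c dF.
    have dcG := differentiableZ c' dG.
    have dHK := differentiable_cross dH dK.
    rewrite (derive_add h (differentiableD dcF dcG) dHK).
    rewrite (derive_add h dcF dcG) (derive_scale c h dF) (derive_scale c' h dG).
    by rewrite (derive_cross h dH dK).
  have Df : mu2 *: 'D_h Y z + (mu1 - mu2) *: 'D_h V z +
       (cross ('D_h V z) (Y z) + cross (V z) ('D_h Y z)) =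
     (mu1 - mu2) *: 'D_h V2 z + mu2 *: 'D_h Y z +
       (cross ('D_h Y z) (V2 z) + cross (Y z) ('D_h V2 z)).
    rewrite -(DL mu2 (mu1 - mu2) _ _ _ _ (dY z) (dV z) (dV z) (dY z)).
    rewrite -(DL (mu1 - mu2) mu2 _ _ _ _ (d2 z) (dY z) (dY z) (d2 z)).
    exact (congr1 (fun F : R * R -> 'cV[R]_3 => 'D_h F z) Ef).
  exact: quat_leibniz Dd Df.
have su' : smooth (fun z => dress (V1 z) (u z)).
  move=> k; apply: CkD; first exact: su.
  by apply: CkZ; apply: Ck_cross; [exact: Ck_cst|exact: s1].
have sQ' : smooth (fun z => Q z - d_x V1 z).
  move=> k; apply: CkD; first exact: sQ.
  by apply: CkN; have [sVx _] := smooth_derive s1; exact: sVx.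
have Yinv z : quat (mu1 - mu2) (Y z) * quat _ _ = 1 := quatVr erefl (m0 z).
have Vx z : d_x V z = riccati_x mu2 (dress (V1 z) (u z)) (V z).
  suff /quat_inj[] : quat 0 (d_x V z) =
      quat 0 (riccati_x mu2 (dress (V1 z) (u z)) (V z)) by [].
  rewrite quat_riccati_x.
  apply: conjugate_derivation (EV z) _ _ (DE z _) (Yinv z).
  - by rewrite -/(d_x V2 z) x2; exact: quat_riccati_x.
  - rewrite DY -/(d_x V1 z) -/(d_x V2 z) x1 x2 difference_x; congr (_ - _).
    by rewrite /laxA mulrDl -!mulrA EV.
apply: backlund_of_diff => // z.
suff /quat_inj[] : quat 0 (d_t V z) =
    quat 0 (riccati_t mu2 (Q z - d_x V1 z) (V z) (d_x V z)) by [].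
rewrite Vx quat_riccati_t.
apply: conjugate_derivation (EV z) _ _ (DE z _) (Yinv z).
- by rewrite -/(d_t V2 z) t2 x2; exact: quat_riccati_t.
- rewrite DY -/(d_t V1 z) -/(d_t V2 z) t1 t2 x1 x2 difference_t; congr (_ - _).
  by rewrite /laxB !mulrDl -!mulrA EV (mulrA (quat mu2 (V z))) EV -!mulrA.
Qed.

End Iteration.

(** * Projections and permutability *)

Section Projections.
Local Open Scope sesquilinear_scope.
Local Notation Re := complex.Re.
Local Notation Im := complex.Im.
Local Notation normc := ComplexField.Normc.normc.
Variable R : realType.
Local Notation C := R[i].
Implicit Types (p alpha beta : C) (pi Y : 'M[C]_2) (v : 'cV[C]_2).

Definition sqnorm v : C := (v^t* *m v) 0 0.

Definition line_proj v : 'M[C]_2 := (sqnorm v)^-1 *: (v *m v^t*).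

(** The image of pi is the line of v, so pi v = v and pi = v y^T. Being Hermitian, pi is also
    conj(y) times the adjoint of v, and applying this to v gives v = |v|^2 conj(y). *)
Lemma herm_proj_unique pi v :
  herm_proj_onto pi v -> sqnorm v != 0 -> pi = line_proj v.
Proof.
case=> hp pp /andP[/submxP[y Ey] /submxP[x Ex]] s0.
have pv : pi *m v = v.
  by rewrite -(trmxK v) Ex trmx_mul trmxK mulmxA pp.
have {}Ey : pi = v *m y^T by rewrite -[LHS]trmxK Ey trmx_mul trmxK.
have {}hp : pi = (y^T)^t* *m v^t* by rewrite -{1}hp Ey trmx_mul map_mxM.
have {}pv : v = sqnorm v *: (y^T)^t*.
  by rewrite -{1}pv hp -mulmxA [v^t* *m v]mx11_scalar mul_mx_scalar.
rewrite /line_proj {2}pv -scalemxAl scalerA mulVf// scale1r; exact: hp.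
Qed.

Lemma line_projZ (c : C) v : c != 0 -> line_proj (c *: v) = line_proj v.
Proof.
move=> c0; have tr : (c *: v)^t* = c^* *: v^t* by rewrite linearZ map_mxZ.
have cc : c * c^* != 0 by rewrite mulf_neq0// conjC_eq0.
have E : sqnorm (c *: v) = (c * c^*) * sqnorm v.
  by rewrite /sqnorm tr -scalemxAl -scalemxAr scalerA mxE [c^* * c]mulrC.
rewrite /line_proj E tr -scalemxAl -scalemxAr !scalerA; congr (_ *: _).
by rewrite -mulrA mulrC invfM mulrA divff// mul1r.
Qed.

(** Y is a scalar multiple of a unitary matrix, so conjugation by it preserves orthogonal
    projections. *)
Lemma line_proj_conj (m : C) Y v : Y^t* *m Y = m%:M -> m != 0 ->
  line_proj (Y *m v) *m Y = Y *m line_proj v.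
Proof.
move=> YY m0; have tr : (Y *m v)^t* = v^t* *m Y^t* by rewrite trmx_mul map_mxM.
rewrite /line_proj /sqnorm tr -[v^t* *m _ *m _]mulmxA.
rewrite [Y^t* *m (_ *m _)]mulmxA YY.
rewrite mul_scalar_mx -scalemxAr mxE invfM -scalemxAl -!mulmxA YY mul_mx_scalar.
by rewrite -!scalemxAr scalerA mulrAC mulVf// mul1r.
Qed.

Lemma sqnorm_affine p :
  sqnorm (affine_vec p) = (1 + (Re p ^+ 2 + Im p ^+ 2))%:C%C.
Proof.
rewrite /sqnorm mxE !big_ord_recl big_ord0 !mxE /=; case: p => r s /=.
by apply/eqP; rewrite eq_complex /=; apply/andP; split; apply/eqP; ring.
Qed.

Lemma normc_sqr p : normc p ^+ 2 = Re p ^+ 2 + Im p ^+ 2.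
Proof. by case: p => r s /=; rewrite sqr_sqrtr// addr_ge0 ?sqr_ge0. Qed.

Lemma denom_neq0 p : 1 + (Re p ^+ 2 + Im p ^+ 2) != 0 :> R.
Proof. by rewrite gt_eqF// ltr_pwDl// addr_ge0 ?sqr_ge0. Qed.

(* The imaginary quaternion - (Im alpha) n, where n in S^2 is the image of p
   under stereographic projection. *)
Definition dress_vec alpha p : 'cV[R]_3 :=
  (- Im alpha / (1 + (Re p ^+ 2 + Im p ^+ 2))) *:
    vec3 (1 - (Re p ^+ 2 + Im p ^+ 2)) (2 * Re p) (2 * Im p).

Lemma dot_dress_vec alpha p :
  dot (dress_vec alpha p) (dress_vec alpha p) = Im alpha ^+ 2.
Proof.
rewrite /dress_vec vec3E vec3E; have := denom_neq0 p.
by move: (Re p) (Im p) (Im alpha) => r s n D0; field.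
Qed.

(** The quaternion X: it acts as alpha on the image of pi and as the conjugate of alpha on the
    orthogonal complement. *)
Definition eigen_mx alpha pi : 'M[C]_2 := alpha *: pi + alpha^* *: (1%:M - pi).

Lemma eigen_mx_line alpha p :
  eigen_mx alpha (line_proj (affine_vec p)) =
  quat (Re alpha) (dress_vec alpha p).
Proof.
rewrite /eigen_mx /line_proj sqnorm_affine -(fmorphV (real_complex R)).
have := denom_neq0 p.
rewrite /dress_vec; case: p => r s /=; case: alpha => a b /= D0.
apply: mx2P; rewrite !mxE !big_ord_recl !big_ord0 !mxE /=;
  apply/eqP; rewrite eq_complex /=; apply/andP; split; apply/eqP; by field.
Qed.

(** Since X v = alpha v, the simple factor at alpha acts on v as X - X' up to a scalar. Thus xi and
    eta are, up to scalars, Y applied to (p1, 1) and (p2, 1). *)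
Lemma simple_factor_eigen_mx alpha beta pi pi' v :
  alpha != beta -> pi *m v = v ->
  simple_factor beta pi' alpha *m v =
  (alpha - beta)^-1 *: ((eigen_mx alpha pi - eigen_mx beta pi') *m v).
Proof.
move=> ab pv; have ab0 : alpha - beta != 0 by rewrite subr_eq0.
rewrite /simple_factor /eigen_mx.
rewrite mulmxDl mul1mx -scalemxAl !mulmxBl !mulmxDl -!scalemxAl !mulmxBl.
rewrite mul1mx pv subrr scaler0 addr0; set w := pi' *m v.
rewrite [_ / _]mulrC -scalerA -[X in X + _](scalerK ab0) -scalerDr.
congr (_ *: _).
by apply/matrixP => i j; rewrite !mxE; ring.
Qed.

Lemma line_proj_id v : sqnorm v != 0 -> line_proj v *m v = v.
Proof.
move=> s0; rewrite /line_proj -scalemxAl -mulmxA [v^t* *m v]mx11_scalar.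
by rewrite mul_mx_scalar scalerA mulVf// scale1r.
Qed.

Lemma sqnorm_affine_neq0 p : sqnorm (affine_vec p) != 0.
Proof. by rewrite sqnorm_affine fmorph_eq0 denom_neq0. Qed.

Lemma affine_vec_ratio v : v 1 0 != 0 ->
  affine_vec (v 0 0 / v 1 0) = (v 1 0)^-1 *: v.
Proof.
move=> v0; apply/matrixP => i j; rewrite (ord1 j) !mxE.
case: i => -[|[|//]] hi /=.
  by rewrite mulrC; congr (_ * v _ _); apply/val_inj.
by rewrite -[LHS](mulVf v0); congr (_ * v _ _); apply/val_inj.
Qed.

Lemma quat_adjoint y0 (Yv : 'cV[R]_3) :
  (quat y0 Yv)^t* *m quat y0 Yv = (y0 ^+ 2 + dot Yv Yv)%:C%C%:M.
Proof.
rewrite quat_tr mulmxE quatM dotNl opprK -expr2 scalerN subrr add0r.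
rewrite -scaleN1r crossZl crossvv scaler0 -scalemx1 -[X in _ = _ *: X]quat1.
by rewrite quatZ scaler0 mulr1.
Qed.

(** The vector [eta] spans the image of the line of p under X - X'. That difference is a nonzero
    quaternion, hence a multiple of a unitary matrix, and conjugation by it carries the projection
    onto the line of p to that onto the line of [eta]. *)
Lemma permuted_quat alpha beta p p' pi pi' :
  let X := quat (Re alpha) (dress_vec alpha p) in
  let X' := quat (Re beta) (dress_vec beta p') in
  let eta := simple_factor beta pi' alpha *m affine_vec p in
  herm_proj_onto pi (affine_vec p) -> herm_proj_onto pi' (affine_vec p') ->
  alpha != beta -> eta 1 0 != 0 ->
  (Re alpha - Re beta) ^+ 2 + dot (dress_vec alpha p - dress_vec beta p')
    (dress_vec alpha p - dress_vec beta p') != 0 ->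
  quat (Re alpha) (dress_vec alpha (eta 0 0 / eta 1 0)) * (X - X') =
  (X - X') * X.
Proof.
move=> X X' eta hpi hpi' ab eta0 m0.
have Epi := herm_proj_unique hpi (sqnorm_affine_neq0 p).
have Epi' := herm_proj_unique hpi' (sqnorm_affine_neq0 p').
have EX : eigen_mx alpha pi = X by rewrite Epi eigen_mx_line.
have EX' : eigen_mx beta pi' = X' by rewrite Epi' eigen_mx_line.
have pv : pi *m affine_vec p = affine_vec p.
  by rewrite Epi line_proj_id// sqnorm_affine_neq0.
have ab0 : (alpha - beta)^-1 != 0 by rewrite invr_eq0 subr_eq0.
have Eeta : eta = (alpha - beta)^-1 *: ((X - X') *m affine_vec p).
  by rewrite /eta (simple_factor_eigen_mx _ ab pv) EX EX'.
have := quat_adjoint (Re alpha - Re beta)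
  (dress_vec alpha p - dress_vec beta p').
have {m0} : (_ : R)%:C%C != 0 := etrans (congr1 negb (fmorph_eq0 _ _)) m0.
move: (_ ^+ 2 + _) => m mC; rewrite -quatB -/X -/X' => YY.
have L : line_proj (affine_vec (eta 0 0 / eta 1 0)) *m (X - X') =
    (X - X') *m pi.
  (* Rescaling the vector leaves its line projection unchanged. *)
  rewrite affine_vec_ratio// Epi line_projZ ?invr_eq0// Eeta line_projZ//.
  exact: (line_proj_conj _ YY mC).
move: (X - X') L => Z L; rewrite -eigen_mx_line -EX -!mulmxE.
move: (line_proj _) L => P L.
rewrite /eigen_mx mulmxDl mulmxDr -!scalemxAl -!scalemxAr !mulmxBl !mulmxBr.
by rewrite mulmx1 mul1mx L.
Qed.

End Projections.

(** * Frames dressed by a projection, and the equality of the two displacements *)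

Section Permutability.
Local Open Scope sesquilinear_scope.
Local Notation Re := complex.Re.
Local Notation Im := complex.Im.
Local Notation normc := ComplexField.Normc.normc.
Variable R : realType.
Local Notation C := R[i].
Implicit Types (p alpha : C) (phi pi : 'M[C]_2) (v V : 'cV[R]_3).

Lemma su2_vecD (X Y : 'M[C]_2) : su2_vec (X + Y) = su2_vec X + su2_vec Y.
Proof.
rewrite /su2_vec -!/(vec3 _ _ _) vec3D !mxE.
by case: (X 0 0) (X 0 1) (Y 0 0) (Y 0 1) => ? ? [? ?] [? ?] [? ?].
Qed.

Lemma su2_vecZ (c : R) (X : 'M[C]_2) : su2_vec (c%:C%C *: X) = c *: su2_vec X.
Proof.
rewrite /su2_vec -!/(vec3 _ _ _) vec3Z !mxE.
by case: (X 0 0) (X 0 1) => ? ? [? ?] /=; rewrite !mul0r addr0 subr0 addr0.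
Qed.

Lemma quat_delta x y z : quat 0 (vec3 x y z) =
  x%:C%C *: mxa R + (y%:C%C *: - mxc R + z%:C%C *: mxb R).
Proof.
apply: mx2P; rewrite !mxE /=; apply/eqP; rewrite eq_complex /=; apply/andP;
  split; apply/eqP; rewrite /= ?mxE /=; ring.
Qed.

Lemma col_Ad_delta phi :
  [/\ col 0 (Ad_delta phi) = su2_vec (phi *m mxa R *m invmx phi),
      col 1 (Ad_delta phi) = su2_vec (- (phi *m mxc R *m invmx phi)) &
      col 2%:R (Ad_delta phi) = su2_vec (phi *m mxb R *m invmx phi)].
Proof. by split; apply/matrixP => i j; rewrite (ord1 j) mxE mxE. Qed.

Lemma Ad_delta_mul phi v :
  Ad_delta phi *m v = su2_vec (phi *m quat 0 v *m invmx phi).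
Proof.
have [x [y [z ->]]] := vec3P v; rewrite col_vec3 quat_delta.
have [-> -> ->] := col_Ad_delta phi.
rewrite !mulmxDr !mulmxDl -!scalemxAr -!scalemxAl mulmxN mulNmx.
by rewrite !su2_vecD !su2_vecZ addrA.
Qed.

(** The factor [psi] is the adjoint of X divided by the conjugate of alpha, hence a scalar multiple
    of X^-1. Scalars drop out of conjugation, so the frame is multiplied by v |-> X^-1 v X. *)
Lemma Ad_delta_dress phi alpha pi V :
  let N := Re alpha ^+ 2 + dot V V in
  phi \in unitmx -> alpha != 0 -> N != 0 -> pi^t* = pi ->
  eigen_mx alpha pi = quat (Re alpha) V ->
  Ad_delta (phi *m (pi + (alpha / alpha^*) *: (1%:M - pi))) =
  Ad_delta phi *m qrot (Re alpha) N V.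
Proof.
move=> N uphi a0 N0 hpi EX; set psi := pi + _; set X := quat (Re alpha) V in EX.
have ac0 : alpha^* != 0 by rewrite conjC_eq0.
have EI : psi = (N%:C%C / alpha^*) *: quat (N^-1 * Re alpha) (N^-1 *: - V).
  have EXt : (eigen_mx alpha pi)^t* = alpha^* *: pi + alpha *: (1%:M - pi).
    move/matrixP: hpi => h; apply/matrixP => i j.
    have := h i j; rewrite !mxE => hij.
    by rewrite rmorphD !rmorphM rmorphB /= conjCK hij rmorph_nat eq_sym.
  have Nc : N%:C%C * (N^-1)%:C%C = 1 by rewrite -rmorphM divff.
  rewrite -quatZ -quat_tr -/X -EX EXt scalerA mulrAC Nc mul1r scalerDr !scalerA.
  by rewrite mulVf// scale1r [_^-1 * _]mulrC.
set J := quat (N^-1 * _) _ in EI.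
have JX : J * X = 1 := quatVl erefl N0.
have XJ : X * J = 1 := quatVr erefl N0.
have c0 : N%:C%C / alpha^* != 0.
  by rewrite mulf_neq0 ?invr_eq0// fmorph_eq0.
have upsi : psi \in unitmx.
  by rewrite EI unitmxZ ?unitfE//; case/mulmx1_unit: JX.
apply: mulmx_vecP => v; rewrite -mulmxA !Ad_delta_mul; congr su2_vec.
have -> : invmx (phi *m psi) = invmx psi *m invmx phi.
  exact: (@invrM _ phi psi).
have K : psi *m quat 0 v = quat 0 (qrot (Re alpha) N V *m v) *m psi.
  have qX : X * quat 0 (qrot (Re alpha) N V *m v) = quat 0 v * X.
    exact: quat_qrot erefl N0.
  rewrite EI -scalemxAl -scalemxAr; congr (_ *: _); rewrite !mulmxE.
  by rewrite -[LHS]mulr1 -XJ !mulrA -(mulrA J (quat 0 v)) -qX mulrA JX mul1r.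
by rewrite -[phi *m psi *m _]mulmxA K !mulmxA mulmxK.
Qed.

Lemma two_step_vec mu1 mu2 N1 N2 (V1 V2 V1' V2' : 'cV[R]_3) :
  let Y := quat mu1 V1 - quat mu2 V2 in
  (mu1 - mu2) ^+ 2 + dot (V1 - V2) (V1 - V2) != 0 ->
  N1 = mu1 ^+ 2 + dot V1 V1 -> N2 = mu2 ^+ 2 + dot V2 V2 ->
  N1 = mu1 ^+ 2 + dot V1' V1' -> N2 = mu2 ^+ 2 + dot V2' V2' ->
  N1 != 0 -> N2 != 0 ->
  quat mu1 V1' * Y = Y * quat mu1 V1 -> quat mu2 V2' * Y = Y * quat mu2 V2 ->
  N1^-1 *: V1 + N2^-1 *: (qrot mu1 N1 V1 *m V2') =
  N2^-1 *: V2 + N1^-1 *: (qrot mu2 N2 V2 *m V1').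
Proof.
move=> Y m0 E1 E2 E1' E2' N10 N20 C1 C2.
have := quatVr (erefl _) m0; rewrite -{1}quatB => YZ.
have [S P] := refactorization erefl C1 C2 YZ.
(* Since (X' X)^-1 (X' + X) = X^-1 + X^-1 X'^-1 X, the second displacement appears rotated by
   [qrot]. *)
have inv_sum mu mu' N N' (V V' : 'cV[R]_3) : N = mu ^+ 2 + dot V V ->
    N' = mu' ^+ 2 + dot V' V' -> N != 0 -> N' != 0 ->
    quat mu' V' * quat mu V * quat (N^-1 * mu + N'^-1 * mu')
      (- (N^-1 *: V + N'^-1 *: (qrot mu N V *m V'))) =
    quat mu' V' + quat mu V.
  move=> EN EN' N0 N0'.
  have XI := quatVr EN N0; have IX := quatVl EN N0.
  have I'X' := quatVr EN' N0'.
  set I := quat (N^-1 * mu) _ in XI IX.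
  have -> : quat (N^-1 * mu + N'^-1 * mu')
      (- (N^-1 *: V + N'^-1 *: (qrot mu N V *m V'))) =
      I + I * quat (N'^-1 * mu') (N'^-1 *: - V') * quat mu V.
    have Ic c : I * quat c 0 * quat mu V = quat c 0.
      by rewrite -(mulr1 c) -(scaler0 _ c) -quatZ quat1 -scalerAr mulr1
        -scalerAl IX.
    have Iv w : I * quat 0 w * quat mu V = quat 0 (qrot mu N V *m w).
      by rewrite -mulrA -(quat_qrot w EN N0) mulrA IX mul1r.
    rewrite -[N'^-1 * mu']addr0 -[N'^-1 *: - V']add0r -quatD mulrDr mulrDl Ic
      Iv.
    rewrite -scalemxAr mulmxN quatD addr0 add0r quatD; congr quat.
    by rewrite opprD !scalerN.
  rewrite mulrDr -mulrA XI mulr1; congr (_ + _).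
  by rewrite !mulrA -(mulrA _ _ I) XI mulr1 I'X' mul1r.
have G1 := inv_sum _ _ _ _ _ _ E1 E2' N10 N20.
have := inv_sum _ _ _ _ _ _ E2 E1' N20 N10.
rewrite -S -P -G1 => /(congr1 (fun x =>
  quat (N1^-1 * mu1) (N1^-1 *: - V1) * (quat (N2^-1 * mu2) (N2^-1 *: - V2') *
    x))).
rewrite -!(mulrA (quat mu2 V2')) !(mulrA (quat (N2^-1 * mu2) _)) !(quatVl
  E2')// !mul1r.
rewrite !(mulrA (quat (N1^-1 * mu1) _)) !(quatVl E1)// !mul1r => /quat_inj[_].
by move/oppr_inj.
Qed.

Lemma BT_curveE alpha (p : R * R -> C) g gamma z :
  BT_curve alpha p g gamma z =
  gamma z - (normc alpha ^+ 2)^-1 *: (g z *m dress_vec alpha (p z)).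
Proof.
rewrite /BT_curve /dress_vec -scalemxAr col_vec3 !normc_sqr; congr (_ + _).
by rewrite scalerA -scaleNr invfM; congr (_ *: _); ring.
Qed.

(** The norm of Y vanishes only if Re alpha1 = Re alpha2 and the two vectors agree; their lengths
    then give Im alpha1 = Im alpha2 up to sign, the two excluded cases. *)
Lemma distinct_neq0 (alpha1 alpha2 p1 p2 : C) :
  alpha1 != alpha2 -> alpha1 != alpha2^* ->
  (Re alpha1 - Re alpha2) ^+ 2 +
    dot (dress_vec alpha1 p1 - dress_vec alpha2 p2)
      (dress_vec alpha1 p1 - dress_vec alpha2 p2) != 0.
Proof.
move=> a12 a12c; apply/negP.
set w := dress_vec _ _ - _.
rewrite /dot -!expr2 !paddr_eq0 ?addr_ge0 ?sqr_ge0// !sqrf_eq0 subr_eq0 =>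
  /andP[/eqP re /andP[/andP[/eqP w0 /eqP w1] /eqP w2]].
have : w = 0.
  by rewrite (vec3_eta w) w0 w1 w2 -(scale0r (vec3 1 1 1)) vec3Z !mul0r.
move/eqP; rewrite subr_eq0 => /eqP E.
have := dot_dress_vec alpha1 p1; rewrite E dot_dress_vec => /esym/eqP.
rewrite eqf_sqr => /orP[] /eqP im.
- by case/eqP: a12; apply/eqP; rewrite eq_complex re im !eqxx.
- have cj (x : C) : x^* = Complex (Re x) (- Im x) by case: x.
  by case/eqP: a12c; apply/eqP; rewrite cj eq_complex /= re im !eqxx.
Qed.

End Permutability.

(** * From BT to the Riccati equations *)

Section BTtoRiccati.
Local Notation Re := complex.Re.
Local Notation Im := complex.Im.
Variable R : realType.
Local Notation C := R[i].

Lemma derive_inv (f : R * R -> R) z h : differentiable f z -> f z != 0 ->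
  'D_h (fun w => (f w)^-1) z = - (f z) ^- 2 * 'D_h f z.
Proof. by move=> df f0; apply: deriveV => //; exact: diff_derivable. Qed.

Lemma real_complex_half : 2^-1 = (2^-1 +i* 0)%C :> C.
Proof. by rewrite -[RHS]/(real_complex R _) fmorphV rmorph_nat. Qed.

Lemma real_complex_two : 2 = (2 +i* 0)%C :> C.
Proof. by rewrite -[RHS]/(real_complex R _) rmorph_nat. Qed.

(* Half the angular velocities of an adapted p-frame in x and in t. *)
Definition u_vec (k1 k2 : R) : 'cV[R]_3 := vec3 0 (- (k2 / 2)) (k1 / 2).

Definition Q_vec (k1 k2 k1x k2x : R) : 'cV[R]_3 :=
  vec3 (- ((k1 ^+ 2 + k2 ^+ 2) / 8)) (- (k1x / 4)) (- (k2x / 4)).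

(** The derivative of [dress_vec] when Re p and Im p have derivatives dr and ds, over the common
    denominator D^2. *)
Definition dress_diff (n r s dr ds : R) : 'cV[R]_3 :=
  let D := 1 + (r ^+ 2 + s ^+ 2) in
  - n / D ^+ 2 *: vec3 (- 4 * (r * dr + s * ds))
     (2 * dr * D - 4 * r * (r * dr + s * ds))
     (2 * ds * D - 4 * s * (r * dr + s * ds)).

Lemma differentiable_vec3 (f g k : R * R -> R) z :
  differentiable f z -> differentiable g z -> differentiable k z ->
  differentiable (fun w => vec3 (f w) (g w) (k w)) z.
Proof.
move=> df dg dk; apply/differentiable_mxP => -[[|[|[|//]]] hi] j;
  by rewrite (ord1 j); under eq_fun do rewrite mxE /=.
Qed.

Lemma derive_vec3 (f g k : R * R -> R) z h :
  differentiable f z -> differentiable g z -> differentiable k z ->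
  'D_h (fun w => vec3 (f w) (g w) (k w)) z =
  vec3 ('D_h f z) ('D_h g z) ('D_h k z).
Proof.
move=> df dg dk; apply/matrixP => i j.
rewrite (derive_coord h i j (differentiable_vec3 df dg dk)) (ord1 j).
by case: i => -[|[|[|//]]] hi; rewrite [RHS]mxE /=;
  under eq_fun do rewrite mxE /=.
Qed.

Lemma derive_scale_fun (c : R * R -> R) (V : R * R -> 'cV[R]_3) z h :
  differentiable c z -> differentiable V z ->
  'D_h (fun w => c w *: V w) z = c z *: 'D_h V z + 'D_h c z *: V z.
Proof.
move=> dc dV; have /differentiable_mxP dVc := dV; apply/matrixP => i j.
rewrite (derive_coord h i j (differentiable_scale_fun dc dV)).
under eq_fun do rewrite mxE.
rewrite (derive_mul h dc (dVc i j)) !mxE (derive_coord h i j dV).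
by rewrite [V z i j * _]mulrC.
Qed.

(** * Derivative of the stereographic image of p *)

Section DressDerivative.
Variables (alpha : C) (p : R * R -> C) (z : R * R).
Hypothesis dp : differentiableC p z.

Let r w := Re (p w).
Let s w := Im (p w).
Let sq w := r w * r w + s w * s w.
Let f w := (1 + sq w)^-1.

Let dr : differentiable r z. Proof. by case: dp. Qed.
Let ds : differentiable s z. Proof. by case: dp. Qed.

Let dsq : differentiable sq z.
Proof. exact (differentiableD (differentiableM dr dr) (differentiableM ds ds)).
Qed.

Let D0 w : 1 + sq w != 0.
Proof. by have := denom_neq0 (p w); rewrite !expr2. Qed.

Let d1sq : differentiable (fun w => 1 + sq w) z.
Proof. exact (differentiableD (differentiable_cst _ _) dsq). Qed.

Let df : differentiable f z.
Proof. exact (differentiableV d1sq (D0 z)). Qed.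

Let dcr c : differentiable (fun w => c * r w) z.
Proof. exact (differentiableM (differentiable_cst c z) dr). Qed.

Let dcs c : differentiable (fun w => c * s w) z.
Proof. exact (differentiableM (differentiable_cst c z) ds). Qed.

Let dNsq : differentiable (fun w => 1 - sq w) z.
Proof. exact (differentiableD (differentiable_cst _ _) (differentiableN dsq)).
Qed.

Let dW : differentiable (fun w => vec3 (1 - sq w) (2 * r w) (2 * s w)) z.
Proof. exact (differentiable_vec3 dNsq (dcr 2) (dcs 2)). Qed.

Let dressE : (fun w => dress_vec alpha (p w)) =
  fun w => - Im alpha *: (f w *: vec3 (1 - sq w) (2 * r w) (2 * s w)).
Proof. by apply/funext => w; rewrite /dress_vec scalerA /f /sq !expr2. Qed.

Lemma differentiable_dress : differentiable (fun w => dress_vec alpha (p w)) z.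
Proof.
by rewrite dressE; exact (differentiableZ _ (differentiable_scale_fun df dW)).
Qed.

Lemma derive_dress h : 'D_h (fun w => dress_vec alpha (p w)) z =
  dress_diff (Im alpha) (Re (p z)) (Im (p z)) ('D_h r z) ('D_h s z).
Proof.
have Dcst (c : R) (g : R * R -> R) :
    differentiable g z -> 'D_h (fun w => c * g w) z = c * 'D_h g z.
  by move=> dg; exact (derive_scale c h dg).
have Dsq : 'D_h sq z = 2 * (r z * 'D_h r z + s z * 'D_h s z).
  rewrite (derive_add h (differentiableM dr dr) (differentiableM ds ds)).
  by rewrite (derive_mul h dr dr) (derive_mul h ds ds); ring.
have D1 : 'D_h (fun w => 1 + sq w) z = 'D_h sq z.
  by rewrite (derive_add h (differentiable_cst _ _) dsq) derive_cst add0r.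
have D2 : 'D_h (fun w => 1 - sq w) z = - 'D_h sq z.
  rewrite (derive_add h (differentiable_cst _ _) (differentiableN dsq))
    derive_cst.
  by rewrite (derive_opp h dsq) add0r.
have Df : 'D_h f z = - (1 + sq z) ^- 2 * 'D_h sq z.
  by rewrite (derive_inv h d1sq (D0 z)) D1.
rewrite dressE (derive_scale _ h (differentiable_scale_fun df dW)).
rewrite (derive_scale_fun h df dW) (derive_vec3 h dNsq (dcr 2) (dcs 2)).
rewrite D2 (Dcst 2 _ dr) (Dcst 2 _ ds) Df Dsq /f /dress_diff -/(r z) -/(s z).
have D0z := D0 z; rewrite !expr2 -/(sq z); move: D0z.
rewrite /sq; move: ('D_h r z) ('D_h s z) (r z) (s z) => x y a b ab0.
by rewrite !vec3E; congr vec3; field.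
Qed.

End DressDerivative.

(** Stereographic projection carries the scalar Riccati equation for p to the vector one on a sphere
    of radius |Im alpha|. *)
Lemma BT_x_riccati (k1 k2 dr ds : R) (alpha p : C) :
  Complex dr ds = - (2^-1 * Complex k1 k2)^* * p ^+ 2
     - 2 * 'i%C * alpha * p - 2^-1 * Complex k1 k2 ->
  dress_diff (Im alpha) (Re p) (Im p) dr ds =
  riccati_x (Re alpha) (u_vec k1 k2) (dress_vec alpha p).
Proof.
have := denom_neq0 p; case: alpha p => a b [r s] /= D0.
rewrite real_complex_half real_complex_two => -[-> ->].
rewrite /dress_diff /riccati_x /u_vec /dress_vec /axis /= !vec3E.
by congr vec3; field.
Qed.

Lemma BT_t_riccati (k1 k2 k1x k2x dr ds : R) (alpha p : C) :
  Complex dr ds =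
   ('i%C / 2 * (Complex (k1x / 2) (k2x / 2))^*
    - alpha * (2^-1 * Complex k1 k2)^*) * p ^+ 2
   + 'i%C * (((k1 ^+ 2 + k2 ^+ 2) / 4)%:C%C - 2 * alpha ^+ 2) * p
   - (alpha * (2^-1 * Complex k1 k2)
      + 'i%C / 2 * Complex (k1x / 2) (k2x / 2)) ->
  let V := dress_vec alpha p in
  dress_diff (Im alpha) (Re p) (Im p) dr ds =
  riccati_t (Re alpha) (Q_vec k1 k2 k1x k2x) V
    (riccati_x (Re alpha) (u_vec k1 k2) V).
Proof.
have := denom_neq0 p; case: alpha p => a b [r s] /= D0.
rewrite real_complex_half real_complex_two => -[-> ->].
rewrite /dress_diff /riccati_t /riccati_x /u_vec /Q_vec /dress_vec /axis /=.
by rewrite !vec3E; congr vec3; field.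
Qed.

End BTtoRiccati.

(** * From an adapted p-frame and BT solutions to framed curves *)

Section Assembly.
Variable R : realType.

Lemma det_mx22 (A : 'M[R]_2) : \det A = A 0 0 * A 1 1 - A 0 1 * A 1 0.
Proof.
rewrite (expand_det_row _ 0) !big_ord_recl big_ord0 /cofactor !det_mx11 !mxE /=.
rewrite expr0 expr1 mul1r addr0 mulN1r mulrN.
by congr (_ * A _ _ - A _ _ * A _ _); exact/val_inj.
Qed.

Lemma det_mx33 (A : 'M[R]_3) : \det A =
  A 0 0 * (A 1 1 * A 2%:R 2%:R - A 1 2%:R * A 2%:R 1)
  - A 0 1 * (A 1 0 * A 2%:R 2%:R - A 1 2%:R * A 2%:R 0)
  + A 0 2%:R * (A 1 0 * A 2%:R 1 - A 1 1 * A 2%:R 0).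
Proof.
pose a i j := A (inord i) (inord j).
have Aa (i j : 'I_3) : A i j = a i j by rewrite /a !inord_val.
rewrite (expand_det_row _ 0) !big_ord_recl big_ord0 /cofactor !det_mx22 !mxE.
by rewrite !Aa /= /bump /= expr0 expr1 expr2; ring.
Qed.

Lemma SO3_cross (g : 'M[R]_3) : SO3 g -> cross_morph g.
Proof.
case=> gg dg v w; have gg' := mulmx1C gg.
(* The cofactor identity, valid for every 3 by 3 matrix; orthogonality and determinant one enter
   afterwards. *)
have K : g^T *m cross (g *m v) (g *m w) = \det g *: cross v w.
  rewrite det_mx33.
  have [x [y [z ->]]] := vec3P v; have [a [b [c ->]]] := vec3P w.
  have E (h : 'M[R]_3) p q r : h *m vec3 p q r =
      vec3 (h 0 0 * p + h 0 1 * q + h 0 2%:R * r)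
        (h 1 0 * p + h 1 1 * q + h 1 2%:R * r)
        (h 2%:R 0 * p + h 2%:R 1 * q + h 2%:R 2%:R * r).
    by rewrite [LHS]vec3_eta col_vec3 !mxE; congr vec3; ring.
  by rewrite !E ?cross_vec3 !vec3_coord vec3Z ![g^T _ _]mxE; congr vec3; ring.
by rewrite -[LHS]mul1mx -gg' -mulmxA K dg scale1r.
Qed.

Lemma Ck_vec3 k (f1 f2 f3 : R * R -> R) : Ck k f1 -> Ck k f2 -> Ck k f3 ->
  Ck k (fun z => vec3 (f1 z) (f2 z) (f3 z)).
Proof.
move=> C1 C2 C3; apply/Ck_mxP => -[[|[|[|//]]] hi] j; rewrite (ord1 j);
  by under eq_fun do rewrite mxE /=.
Qed.

(** The curvatures are entries of g^T g_x and inherit the smoothness of g; the transpose replaces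
    the inverse because its entries are visibly smooth. *)
Lemma pframe_smooth gamma g (k1 k2 : R * R -> R) :
  adapted_pframe gamma g k1 k2 -> smooth k1 /\ smooth k2.
Proof.
case=> sg gSO _ gx _; have [sgx _] := smooth_derive sg.
have inv z : invmx (g z) = (g z)^T.
  have [gg _] := gSO z; have [_ ug] := mulmx1_unit gg.
  by rewrite -[LHS]mul1mx -gg mulmxK.
have sM k i : Ck k (fun z => ((g z)^T *m d_x g z) i 0).
  have CgT : Ck k (fun z => (g z)^T).
    apply/Ck_mxP => a b; under eq_fun do rewrite mxE.
    by have /Ck_mxP := sg k; apply.
  by have /Ck_mxP := Ck_mulmx CgT (sgx k); apply.
split=> k.
- rewrite (_ : k1 = fun z => ((g z)^T *m d_x g z) 1 0); first exact: sM.
  by apply/funext => z; rewrite -inv gx mxE.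
- rewrite (_ : k2 = fun z => ((g z)^T *m d_x g z) 2%:R 0); first exact: sM.
  by apply/funext => z; rewrite -inv gx mxE.
Qed.

Section Curvatures.
Variables (k1 k2 : R * R -> R).
Hypotheses (sk1 : smooth k1) (sk2 : smooth k2).

Lemma smooth_u_vec : smooth (fun z => u_vec (k1 z) (k2 z)).
Proof.
move=> k; apply: Ck_vec3; first exact: Ck_cst.
- rewrite (_ : (fun z => _) = fun z => - 2^-1 * k2 z).
    by apply: CkM; [exact: Ck_cst|exact: sk2].
  by apply/funext => z; ring.
- by apply: CkM; [exact: sk1|exact: Ck_cst].
Qed.

Lemma smooth_Q_vec :
  smooth (fun z => Q_vec (k1 z) (k2 z) (d_x k1 z) (d_x k2 z)).
Proof.
have [sk1x _] := smooth_derive sk1; have [sk2x _] := smooth_derive sk2.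
move=> k; apply: Ck_vec3.
- rewrite (_ : (fun z => _) = fun z => - 8^-1 * (k1 z * k1 z + k2 z * k2 z)).
    apply: CkM; first exact: Ck_cst.
    by apply: CkD; apply: CkM; [exact: sk1|exact: sk1|exact: sk2|exact: sk2].
  by apply/funext => z; ring.
- rewrite (_ : (fun z => _) = fun z => - 4^-1 * d_x k1 z).
    by apply: CkM; [exact: Ck_cst|exact: sk1x].
  by apply/funext => z; ring.
- rewrite (_ : (fun z => _) = fun z => - 4^-1 * d_x k2 z).
    by apply: CkM; [exact: Ck_cst|exact: sk2x].
  by apply/funext => z; ring.
Qed.

(** Here gamma_t = g u is deduced from the VFE, by the computation of [framed_VFE] read
    backwards. *)
Lemma pframe_framed gamma g : VFE_solution gamma ->
  adapted_pframe gamma g k1 k2 ->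
  framed gamma g (fun z => u_vec (k1 z) (k2 z))
    (fun z => Q_vec (k1 z) (k2 z) (d_x k1 z) (d_x k2 z)).
Proof.
move=> [sgamma gt] [sg gSO gx ggx ggt].
have gK z (A : 'M[R]_3) : g z *m (invmx (g z) *m A) = A.
  have [gg _] := gSO z; have [_ ug] := mulmx1_unit gg.
  by rewrite mulmxA mulmxV// mul1mx.
have Gx z : d_x gamma z = g z *m axis R.
  by rewrite -gx col_vec3 scale1r !scale0r !addr0.
have GGx z : d_x g z = g z *m hat (2 *: u_vec (k1 z) (k2 z)).
  rewrite -[LHS](gK z) ggx; congr (_ *m _).
  by apply/matrixP => -[[|[|[|//]]] hi] [[|[|[|//]]] hj]; rewrite !mxE /=;
    field.
have perp z : dot (axis R) (u_vec (k1 z) (k2 z)) = 0 by rewrite dot_vec3; ring.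
have crs z : cross_morph (g z) := SO3_cross (gSO z).
split=> //.
- exact: smooth_u_vec.
- exact: smooth_Q_vec.
- move=> z; rewrite gt.
  have -> : d_x gamma = fun z => g z *m axis R by apply/funext.
  rewrite /d_x derive_mulmx; [|exact: smooth_diff|exact: differentiable_cst].
  rewrite derive_cst mulmx0 addr0 -/(d_x g z) GGx -mulmxA hat_mul.
  by rewrite crs scalemxAr crossZl cross_cross_axis.
- move=> z; rewrite -[LHS](gK z) ggt; congr (_ *m _).
  by apply/matrixP => -[[|[|[|//]]] hi] [[|[|[|//]]] hj]; rewrite !mxE /=;
    field.
Qed.

Lemma dC_x_q z : dC_x (fun z => 2^-1 * Complex (k1 z) (k2 z)) z =
  Complex (d_x k1 z / 2) (d_x k2 z / 2).
Proof.
rewrite /dC_x; congr Complex.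
- rewrite (_ : (fun w => _) = fun w => 2^-1 * k1 w).
    by rewrite mulrC; exact: (derive_scale _ _ (smooth_diff z sk1)).
  by apply/funext => w; rewrite real_complex_half /= mul0r subr0.
- rewrite (_ : (fun w => _) = fun w => 2^-1 * k2 w).
    by rewrite mulrC; exact: (derive_scale _ _ (smooth_diff z sk2)).
  by apply/funext => w; rewrite real_complex_half /= mul0r addr0.
Qed.

Lemma BT_backlund alpha p :
  BT_solution (fun z => 2^-1 * Complex (k1 z) (k2 z)) alpha p ->
  backlund (complex.Re alpha) (ComplexField.Normc.normc alpha ^+ 2)
    (fun z => u_vec (k1 z) (k2 z))
    (fun z => Q_vec (k1 z) (k2 z) (d_x k1 z) (d_x k2 z))
    (fun z => dress_vec alpha (p z)).
Proof.
case=> dp px pt.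
have Vx z : d_x (fun z => dress_vec alpha (p z)) z =
    riccati_x (complex.Re alpha) (u_vec (k1 z) (k2 z)) (dress_vec alpha (p z)).
  by rewrite /d_x derive_dress//; exact: BT_x_riccati (px z).
apply: backlund_of_diff => //.
- exact: smooth_u_vec.
- exact: smooth_Q_vec.
- by move=> z; exact: differentiable_dress.
- by move=> z; rewrite normc_sqr dot_dress_vec.
- move=> z; rewrite Vx {1}/d_t derive_dress//; apply: BT_t_riccati.
  have := pt z; rewrite dC_x_q normc_sqr /dC_t => ->.
  congr (_ + _ * (_%:C%C - _) * _ - _).
  by rewrite real_complex_half /=; field.
Qed.

End Curvatures.

End Assembly.

Theorem theorem6p10 (R : realType)
  (gamma : R * R -> 'cV[R]_3) (g : R * R -> 'M[R]_3) (k1 k2 : R * R -> R)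
  (alpha1 alpha2 : R[i]) (p1 p2 : R * R -> R[i])
  (pi1 pi2 phi : R * R -> 'M[R[i]]_2)
  (hgamma : VFE_solution gamma) (hgamma1 : arclength gamma)
  (hg : adapted_pframe gamma g k1 k2)
  (halpha1 : complex.Im alpha1 != 0) (halpha2 : complex.Im alpha2 != 0)
  (halpha12 : alpha1 != alpha2) (halpha12c : alpha1 != alpha2^*) :
  let q := fun z : R * R => 2^-1 * (k1 z +i* k2 z)%C in
  forall (hp1 : BT_solution q alpha1 p1) (hp2 : BT_solution q alpha2 p2)
    (hpi1 : forall z, herm_proj_onto (pi1 z) (affine_vec (p1 z)))
    (hpi2 : forall z, herm_proj_onto (pi2 z) (affine_vec (p2 z)))
    (hphi : smoothCmx phi) (hphiSU : forall z, SU2 (phi z))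
    (hphig : forall z, g z = Ad_delta (phi z)),
  let phi1 := BT_trivialization alpha1 pi1 phi in
  let phi2 := BT_trivialization alpha2 pi2 phi in
  let g1 := fun z => Ad_delta (phi1 z) in
  let g2 := fun z => Ad_delta (phi2 z) in
  let gamma1 := BT_curve alpha1 p1 g gamma in
  let gamma2 := BT_curve alpha2 p2 g gamma in
  let xi := fun z =>
    simple_factor alpha2 (pi2 z) alpha1 *m affine_vec (p1 z) in
  let eta := fun z =>
    simple_factor alpha1 (pi1 z) alpha2 *m affine_vec (p2 z) in
  forall (hxi : forall z, xi z 1 0 != 0) (heta : forall z, eta z 1 0 != 0),
  let pt1 := fun z => xi z 0 0 / xi z 1 0 in
  let pt2 := fun z => eta z 0 0 / eta z 1 0 in
  let gamma12 := BT_curve alpha2 pt2 g1 gamma1 in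
  (forall z, gamma12 z = BT_curve alpha1 pt1 g2 gamma2 z) /\
  VFE_solution gamma12.
Proof.
move=> q hp1 hp2 hpi1 hpi2 _ hphiSU hphig phi1 phi2 g1 g2 gamma1 gamma2 xi eta
  hxi heta pt1 pt2 gamma12.
have [sk1 sk2] := pframe_smooth hg.
have F := pframe_framed sk1 sk2 hgamma hg.
have B1 := BT_backlund sk1 sk2 hp1; have B2 := BT_backlund sk1 sk2 hp2.
have a10 : alpha1 != 0 by apply: contraNneq halpha1 => ->.
have a20 : alpha2 != 0 by apply: contraNneq halpha2 => ->.
pose N (alpha : R[i]) : R := ComplexField.Normc.normc alpha ^+ 2.
have N0 (alpha : R[i]) : complex.Im alpha != 0 -> N alpha != 0.
  move=> a0; rewrite /N normc_sqr gt_eqF// ltr_wpDl ?sqr_ge0//.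
  by rewrite exprn_even_gt0.
have EN alpha p : N alpha =
    complex.Re alpha ^+ 2 + dot (dress_vec alpha p) (dress_vec alpha p).
  by rewrite /N normc_sqr dot_dress_vec.
have halpha21 : alpha2 != alpha1 by rewrite eq_sym.
have halpha21c : alpha2 != alpha1^*.
  by apply: contraNneq halpha12c => ->; rewrite conjCK.
(* X1' and X2' are conjugates by the same Y = X1 - X2: exchanging the roles of 1 and 2 changes the
   sign of Y on both sides of the relation. *)
have C1 z : quat _ _ * _ = _ := permuted_quat (hpi1 z) (hpi2 z) halpha12 (hxi z)
  (distinct_neq0 (p1 z) (p2 z) halpha12 halpha12c).
have C2 z : quat (complex.Re alpha2) (dress_vec alpha2 (pt2 z)) *
    (quat (complex.Re alpha1) (dress_vec alpha1 (p1 z))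
     - quat (complex.Re alpha2) (dress_vec alpha2 (p2 z))) =
    (quat (complex.Re alpha1) (dress_vec alpha1 (p1 z))
     - quat (complex.Re alpha2) (dress_vec alpha2 (p2 z))) *
    quat (complex.Re alpha2) (dress_vec alpha2 (p2 z)).
  have := permuted_quat (hpi2 z) (hpi1 z) halpha21 (heta z)
    (distinct_neq0 (p2 z) (p1 z) halpha21 halpha21c).
  by rewrite -[_ - quat (complex.Re alpha1) _]opprB mulrN mulNr => /oppr_inj.
have uphi z : phi z \in unitmx.
  by have [_ dphi] := hphiSU z; rewrite unitmxE dphi unitr1.
(* The frames defined through the trivializations are those of [framed_step]. *)
have Eg alpha pi p z : herm_proj_onto (pi z) (affine_vec (p z)) -> alpha != 0 ->
    N alpha != 0 -> Ad_delta (BT_trivialization alpha pi phi z) =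
    g z *m qrot (complex.Re alpha) (N alpha) (dress_vec alpha (p z)).
  move=> hpi a0 Na0; rewrite hphig (EN alpha (p z)).
  apply: Ad_delta_dress => //.
  - by rewrite -EN.
  - by case: hpi.
  - by rewrite (herm_proj_unique hpi (sqnorm_affine_neq0 _)) eigen_mx_line.
have Eg1 z := Eg alpha1 pi1 p1 z (hpi1 z) a10 (N0 _ halpha1).
have Eg2 z := Eg alpha2 pi2 p2 z (hpi2 z) a20 (N0 _ halpha2).
have E12 z : gamma12 z =
    gamma z - (N alpha1)^-1 *: (g z *m dress_vec alpha1 (p1 z))
    - (N alpha2)^-1 *: (g z *m qrot (complex.Re alpha1) (N alpha1)
        (dress_vec alpha1 (p1 z)) *m dress_vec alpha2 (pt2 z)).
  by rewrite /gamma12 BT_curveE /gamma1 BT_curveE /g1 Eg1.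
have E21 z : BT_curve alpha1 pt1 g2 gamma2 z =
    gamma z - (N alpha2)^-1 *: (g z *m dress_vec alpha2 (p2 z))
    - (N alpha1)^-1 *: (g z *m qrot (complex.Re alpha2) (N alpha2)
        (dress_vec alpha2 (p2 z)) *m dress_vec alpha1 (pt1 z)).
  by rewrite BT_curveE /gamma2 BT_curveE /g2 Eg2.
(* Collects two successive displacements into one vector of the frame g, the form compared by
   [two_step_vec]. *)
have D (c : 'cV[R]_3) (G P : 'M[R]_3) n m a b :
    c - n *: (G *m a) - m *: (G *m P *m b) = c - G *m (n *: a + m *: (P *m b)).
  by rewrite mulmxDr -!scalemxAr mulmxA opprD addrA.
split=> [z|].
  have S := two_step_vec (distinct_neq0 (p1 z) (p2 z) halpha12 halpha12c)
    (EN _ _) (EN _ _) (EN _ _) (EN _ _) (N0 _ halpha1) (N0 _ halpha2)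
    (C1 z) (C2 z).
  rewrite E12 E21; apply: etrans (D _ _ _ _ _ _ _) _.
  apply: etrans (congr1 (fun v => gamma z - g z *m v) S) _.
  exact: esym (D _ _ _ _ _ _ _).
(* For the VFE, a step by X1 is followed by a step by X2', which solves the Lax equations of the
   frame transformed by X1. *)
have B2' := backlund_iterate (smooth_u_vec sk1 sk2) (smooth_Q_vec sk1 sk2) B1 B2
  (fun z => distinct_neq0 (p1 z) (p2 z) halpha12 halpha12c).
have F1 := framed_step (N0 _ halpha1) F B1.
have F2 := framed_step (N0 _ halpha2) F1
  (B2' (fun z => dress_vec alpha2 (pt2 z)) _ (fun z => EN alpha2 (pt2 z))).
suff -> : gamma12 = fun z =>
    gamma z - (N alpha1)^-1 *: (g z *m dress_vec alpha1 (p1 z))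
    - (N alpha2)^-1 *: (g z *m qrot (complex.Re alpha1) (N alpha1)
        (dress_vec alpha1 (p1 z)) *m dress_vec alpha2 (pt2 z)).
  by apply: framed_VFE (F2 _) => z; rewrite -quatB; exact: C2.
by apply/funext => z; exact: E12.
Qed.
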